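(* Let $A$ be a finite-dimensional Nakayama algebra over a field. Let $S_1,\dots,S_r$ be the simple modules (up to isomorphism), let $P_i$ be the projective cover of $S_i$, and let $c_i$ be the composition length of $P_i$. Let $I_i$ be the injective envelope of $S_i$, and let $d_i$ be its composition length. Then the following hold. (1) There is a graded lattice isomorphism $\mathcal L_{\mathrm{quot}}(A)\cong\prod_{i=1}^r[0,c_i]$. (2) There is a graded lattice isomorphism $\mathcal L_{\mathrm{sub}}(A)\cong\prod_{i=1}^r[0,d_i]$, and the multisets $\{c_1,\dots,c_r\}$ and $\{d_1,\dots,d_r\}$ are equal. In particular, $\mathcal L_{\mathrm{quot}}(A)\cong\mathcal L_{\mathrm{sub}}(A)$ as graded lattices. (3) One has $R_{\mathrm{quot}}(A;q)=R_{\mathrm{sub}}(A;q)=\prod_{i=1}^r[c_i+1]_q$.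
   Context: A finite-dimensional algebra is Nakayama if all its indecomposable projective and injective modules are uniserial. Modules are finitely generated right modules. All subcategories are full, additive, and closed under isomorphisms and direct summands. $\mathrm{ind}\,A$ is a set of representatives of the isomorphism classes of indecomposable modules, $\mathrm{ind}\,\mathcal C$ is the set of members of $\mathrm{ind}\,A$ in the subcategory $\mathcal C$, and the size of $\mathcal C$ is $|\mathrm{ind}\,\mathcal C|$. $\mathcal L_{\mathrm{quot}}(A)$ (resp. $\mathcal L_{\mathrm{sub}}(A)$) is the lattice, ordered by inclusion, of subcategories of $\mathrm{mod}\,A$ closed under factor modules (resp. submodules), graded by size. $R_{\mathrm{quot}}(A;q)=\sum_i a_iq^i$ and $R_{\mathrm{sub}}(A;q)=\sum_i b_iq^i$, where $a_i$ (resp. $b_i$) is the number of members of $\mathcal L_{\mathrm{quot}}(A)$ (resp. $\mathcal L_{\mathrm{sub}}(A)$) of size $i$. For an integer $c\ge0$, $[0,c]$ is the chain $0<1<\cdots<c$, in which the grade of an element is its integer value; a product of chains is graded by the sum of the coordinates. A graded lattice isomorphism is a lattice isomorphism preserving grades. $[a]_q=1+q+\cdots+q^{a-1}$. *)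

(* Defs.v *)
From HB Require Import structures.
From mathcomp Require Import all_boot all_order all_algebra all_field.
From mathcomp Require Import finmap.
From mathcomp Require Import boolp classical_sets functions cardinality fsbigop.

Set Implicit Arguments.
Unset Strict Implicit.
Unset Printing Implicit Defensive.

Import Order.TTheory GRing.Theory.

Local Open Scope ring_scope.
Local Open Scope classical_set_scope.

Definition finitely_generated (R : pzRingType) (V : lmodType R) : Prop :=
  exists (n : nat) (x : 'I_n -> V),
    forall y, exists a : 'I_n -> R, y = \sum_(i < n) a i *: x i.

Definition lmod_iso (R : pzRingType) (V W : lmodType R) : Prop :=
  exists f : {linear V -> W}, bijective f.

(* A finitely generated right A-module, presented on a space of row vectors    *)
(* by the matrices of the right multiplications v |-> v a.  Up to isomorphism  *)
(* this is every finitely generated right A-module (fgmod_complete below); the *)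
(* type of all lmodTypes is too large to carry a choiceType structure, hence   *)
(* to carry the order structures of the library.                               *)
Record fgmod (F : fieldType) (A : falgType F) := FgMod {
  fgmod_dim : nat;
  fgmod_act : A -> 'M[F]_fgmod_dim;
  fgmod_actP : linear fgmod_act;
  fgmod_act1 : fgmod_act 1 = 1%:M;
  fgmod_actM : forall a b, fgmod_act (a * b) = fgmod_act a *m fgmod_act b }.

HB.instance Definition _ (F : fieldType) (A : falgType F) :=
  gen_eqMixin (fgmod A).
HB.instance Definition _ (F : fieldType) (A : falgType F) :=
  gen_choiceMixin (fgmod A).

Definition fgmod_car (F : fieldType) (A : falgType F) (M : fgmod A) : Type :=
  'rV[F]_(fgmod_dim M).

Coercion fgmod_car : fgmod >-> Sortclass.

HB.instance Definition _ F A (M : @fgmod F A) :=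
  GRing.Zmodule.copy (fgmod_car M) 'rV[F]_(fgmod_dim M).

(* Right A-modules are left modules over the converse ring A^c: below, a *: x  *)
(* is the right action x a.                                                    *)
Section FgModLmodule.
Context {F : fieldType} {A : falgType F} (M : fgmod A).

Definition fgmod_scale (a : A^c) (x : fgmod_car M) : fgmod_car M :=
  (x : 'rV_(fgmod_dim M)) *m fgmod_act M a.

Lemma fgmod_scaleA a b x :
  fgmod_scale a (fgmod_scale b x) = fgmod_scale (a * b) x.
Proof. by rewrite /fgmod_scale -mulmxA -fgmod_actM. Qed.

Lemma fgmod_scale1 : left_id 1 fgmod_scale.
Proof. by move=> x; rewrite /fgmod_scale fgmod_act1 mulmx1. Qed.

Lemma fgmod_scaleDr : right_distributive fgmod_scale +%R.
Proof. by move=> a x y; rewrite /fgmod_scale mulmxDl. Qed.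

Lemma fgmod_scaleDl x : {morph fgmod_scale^~ x : a b / a + b}.
Proof.
move=> a b; rewrite /fgmod_scale -mulmxDr; congr (_ *m _).
by have := fgmod_actP M 1 a b; rewrite !scale1r.
Qed.

HB.instance Definition _ := GRing.Zmodule_isLmodule.Build A^c (fgmod_car M)
  fgmod_scaleA fgmod_scale1 fgmod_scaleDr fgmod_scaleDl.

End FgModLmodule.

Section FgModComplete.
Context {F : fieldType} {A : falgType F} (V : lmodType A^c).

Let sc (k : F) (x : V) : V := (k%:A : A^c) *: x.

Let scC (a : A^c) k x : a *: sc k x = sc k (a *: x).
Proof.
rewrite /sc !scalerA; congr (_ *: _).
rewrite -[LHS]/((k%:A : A) * (a : A)) -[RHS]/((a : A) * (k%:A : A)).
by rewrite mulr_algl mulr_algr.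
Qed.

Let scA k l x : sc k (sc l x) = sc (k * l) x.
Proof.
rewrite /sc scalerA; congr (_ *: _).
rewrite -[LHS]/((l%:A : A) * (k%:A : A)).
by rewrite mulr_algl scalerA mulrC.
Qed.

Let sc1 x : sc 1 x = x.
Proof. by rewrite /sc (scale1r (1 : A)); exact: (scale1r x). Qed.

Let scDl k l x : sc (k + l) x = sc k x + sc l x.
Proof. by rewrite /sc (scalerDl (1 : A)); exact: (scalerDl x). Qed.

Let sc0 x : sc 0 x = 0.
Proof. by rewrite /sc (scale0r (1 : A)); exact: (scale0r x). Qed.

Let scN k x : sc (- k) x = - sc k x.
Proof. by apply/eqP; rewrite -addr_eq0 -scDl addNr sc0. Qed.

Let sc_sum (T : finType) k (g : T -> V) :
  sc k (\sum_i g i) = \sum_i sc k (g i).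
Proof. exact: scaler_sumr. Qed.

Let spans (T : finType) (v : T -> V) :=
  forall y, exists c : T -> F, y = \sum_i sc (c i) (v i).

Lemma fgmod_complete : finitely_generated V -> exists M : fgmod A, lmod_iso M V.
Proof.
move=> [n [x hx]].
have [m0 [v0 hv0]] : exists m (v : 'I_m -> V), spans v.
  pose e := vbasis {:A}; pose d := \dim {:A}.
  pose w (p : 'I_n * 'I_d) : V := (e`_p.2 : A^c) *: x p.1.
  have hw : spans w.
    move=> y; have [a ->] := hx y.
    exists (fun p => coord e p.2 (a p.1)).
    rewrite -(pair_bigA _ (fun i j => sc (coord e j (a i)) (w (i, j)))) /=.
    apply: eq_bigr => i _.
    rewrite {1}(coord_vbasis (memvf (a i : A))).
    rewrite -[LHS]/((\sum_(j < d) coord e j (a i) *: e`_j : A^c) *: x i).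
    rewrite scaler_suml; apply: eq_bigr => j _.
    rewrite /w /sc scalerA; congr (_ *: _).
    rewrite -[RHS]/((e`_j : A) * ((coord e j (a i))%:A : A)).
    by rewrite mulr_algr.
  exists #|{: 'I_n * 'I_d}|, (w \o enum_val) => y.
  have [c ->] := hw y; exists (c \o enum_val).
  by rewrite (reindex _ (onW_bij _ (enum_val_bij _))).
pose Q m := `[< exists v : 'I_m -> V, spans v >].
have exQ : exists m, Q m by exists m0; apply/asboolP; exists v0.
case: (ex_minnP exQ) => m /asboolP[v hv] minm.
pose phi (c : 'rV[F]_m) : V := \sum_i sc (c 0 i) (v i).
have phiD c c' : phi (c + c') = phi c + phi c'.
  by rewrite /phi -big_split; apply: eq_bigr => i _; rewrite mxE scDl.
have phiZ k c : phi (k *: c) = sc k (phi c).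
  by rewrite /phi sc_sum; apply: eq_bigr => i _; rewrite mxE scA.
have phi_ker c : phi c = 0 -> c = 0.
  move=> c0; apply/rowP => j; rewrite mxE; apply/eqP; apply: contraT => cj.
  case: m => [|m] in v hv minm phi phiD phiZ c c0 j cj *; first by case: j cj.
  suff /minm : Q m by rewrite ltnn.
  apply/asboolP; exists (v \o lift j) => y; have [b ->] := hv y.
  exists (fun i => b (lift j i) - b j * (c 0 j)^-1 * c 0 (lift j i)).
  have vj : sc (b j) (v j)
      = - \sum_i sc (b j * (c 0 j)^-1 * c 0 (lift j i)) (v (lift j i)).
    move: c0; rewrite /phi (bigD1_ord j) //= => /(congr1 (sc (b j * (c 0 j)^-1))).
    rewrite /sc scaler0 scalerDr -!/(sc _ _) scA mulfVK //.
    move/eqP; rewrite addr_eq0 => /eqP ->; rewrite sc_sum.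
    by congr (- _); apply: eq_bigr => i _; rewrite scA.
  rewrite (bigD1_ord j) //= vj addrC -sumrB; apply: eq_bigr => i _ /=.
  by rewrite scDl scN.
have phi_inj : injective phi.
  move=> c c' cc'; apply/eqP; rewrite -subr_eq0; apply/eqP; apply: phi_ker.
  rewrite phiD -scaleN1r phiZ cc' -{1}[phi c']sc1 -scDl.
  by rewrite subrr sc0.
have phi_surj y : exists c, phi c = y.
  have [c ->] := hv y; exists (\row_i c i).
  by apply: eq_bigr => i _; rewrite mxE.
have [g gK] := choice phi_surj.
have phiK : cancel phi g by move=> c; apply: phi_inj; rewrite gK.
pose act (a : A) : 'M[F]_m := \matrix_i g ((a : A^c) *: v i).
have phi_sum (T : finType) (h : T -> 'rV_m) :
    phi (\sum_i h i) = \sum_i phi (h i).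
  apply: (big_morph phi phiD).
  by rewrite /phi big1 // => i _; rewrite mxE sc0.
have phi_act c a : phi (c *m act a) = (a : A^c) *: phi c.
  rewrite mulmx_sum_row phi_sum [phi c]/phi scaler_sumr.
  by apply: eq_bigr => i _; rewrite phiZ rowK gK scC.
have act_inj B B' : (forall c, phi (c *m B) = phi (c *m B')) -> B = B'.
  by move=> BB'; apply/row_matrixP => i; rewrite !rowE; apply: phi_inj.
have actP : linear act.
  move=> k a b; apply: act_inj => c.
  rewrite mulmxDr phiD -scalemxAr phiZ !phi_act -scC /sc.
  rewrite scalerA -scalerDl; congr (_ *: _); congr (_ + _).
  rewrite -[RHS]/((k%:A : A) * (a : A)).
  by rewrite mulr_algl.
have act1 : act 1 = 1%:M.
  by apply: act_inj => c; rewrite phi_act mulmx1 -[RHS]scale1r.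
have actM a b : act (a * b) = act a *m act b.
  apply: act_inj => c; rewrite mulmxA !phi_act scalerA.
  by congr (_ *: _).
pose M := FgMod actP act1 actM.
pose f : M -> V := phi.
have f_lin : linear f.
  move=> a c c'; rewrite -[RHS]/((a : A^c) *: phi c + phi c') -phi_act.
  exact: phiD.
pose Hf := GRing.isLinear.Build _ _ _ _ f f_lin.
pose fL : {linear M -> V} := HB.pack f Hf.
by exists M, fL; exists g.
Qed.

End FgModComplete.

Section Modules.
Context {F : fieldType} {A : falgType F}.
Implicit Types (M N P I X Y Z : fgmod A).

Definition surjective M N (f : M -> N) : Prop := forall y, exists x, f x = y.

Definition iso M N : Prop := lmod_iso M N.

Definition zero_mod M : Prop := forall x : M, x = 0.

Definition indecomposable M : Prop :=
  ~ zero_mod M /\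
  forall X Y, lmod_iso M (X * Y)%type -> zero_mod X \/ zero_mod Y.

Definition simple_mod M : Prop :=
  ~ zero_mod M /\
  forall U : {pred M}, GRing.submod_closed U -> U =i pred1 0 \/ U =i predT.

Definition uniserial M : Prop :=
  forall U V : {pred M}, GRing.submod_closed U -> GRing.submod_closed V ->
    {subset U <= V} \/ {subset V <= U}.

(* V / U is a simple module. *)
Definition simple_factor M (U V : {pred M}) : Prop :=
  [/\ {subset U <= V}, ~ {subset V <= U} &
      forall W : {pred M}, GRing.submod_closed W ->
        {subset U <= W} -> {subset W <= V} ->
        {subset W <= U} \/ {subset V <= W}].

Definition composition_length M (n : nat) : Prop :=
  exists U : nat -> {pred M},
    [/\ forall k, (k <= n)%N -> GRing.submod_closed (U k),
        U 0%N =i pred1 0, U n =i predT &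
        forall k, (k < n)%N -> simple_factor (U k) (U k.+1)].

Definition projective P : Prop :=
  forall M N (g : {linear M -> N}) (h : {linear P -> N}),
    surjective g -> exists k : {linear P -> M}, forall x, g (k x) = h x.

Definition injective_mod I : Prop :=
  forall M N (g : {linear M -> N}) (h : {linear M -> I}),
    injective g -> exists k : {linear N -> I}, forall x, k (g x) = h x.

Definition projective_cover P M : Prop :=
  projective P /\
  exists p : {linear P -> M}, surjective p /\
    forall U : {pred P}, GRing.submod_closed U ->
      (forall x, exists u k, [/\ u \in U, p k = 0 & x = u + k]) ->
      U =i predT.

Definition injective_envelope I M : Prop :=
  injective_mod I /\
  exists j : {linear M -> I}, injective j /\
    forall U : {pred I}, GRing.submod_closed U ->
      (forall x, j x \in U -> j x = 0) -> U =i pred1 0.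

(* choose only depends on the extent of the predicate, hence it selects the    *)
(* same module in all of an isomorphism class.                                 *)
Definition iso_repr M : fgmod A := choose (fun N => `[< iso M N >]) M.

Definition is_factor M N : Prop := exists f : {linear M -> N}, surjective f.

Definition is_sub M N : Prop := exists f : {linear N -> M}, injective f.

Record is_subcat (C : set (fgmod A)) : Prop := IsSubcat {
  subcat0 : forall M, zero_mod M -> C M;
  subcat_iso : forall M N, iso M N -> C M -> C N;
  subcat_dsum : forall X Y Z, lmod_iso Z (X * Y)%type -> C X -> C Y -> C Z;
  subcat_summand : forall X Y Z, lmod_iso Z (X * Y)%type -> C Z -> C X /\ C Y }.

End Modules.

Definition nakayama (F : fieldType) (A : falgType F) : Prop :=
  forall M : fgmod A, indecomposable M -> projective M \/ injective_mod M ->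
    uniserial M.

Definition ind (F : fieldType) (A : falgType F) : set (fgmod A) :=
  [set M | indecomposable M /\ iso_repr M = M].
Arguments ind {F} A.

Record closed_subcat (F : fieldType) (A : falgType F)
    (K : fgmod A -> fgmod A -> Prop) := ClosedSubcat {
  subcat_obj :> set (fgmod A);
  subcatP : is_subcat subcat_obj;
  subcat_closed : forall M N, K M N -> subcat_obj M -> subcat_obj N }.

HB.instance Definition _ F A K := gen_eqMixin (@closed_subcat F A K).
HB.instance Definition _ F A K := gen_choiceMixin (@closed_subcat F A K).

Fact subcat_display : Order.disp_t. Proof. exact: Order.Disp tt tt. Qed.
Fact chain_display : Order.disp_t. Proof. exact: Order.Disp tt tt. Qed.

Section SubcatLattice.
Context {F : fieldType} {A : falgType F} {K : fgmod A -> fgmod A -> Prop}.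
Local Notation L := (closed_subcat K).
Implicit Types C D E : L.

Lemma closed_subcat_inj C D : C = D :> set _ -> C = D.
Proof.
case: C D => [C p q] [D p' q'] /= CD; subst D.
by congr ClosedSubcat; apply: Prop_irrelevance.
Qed.

Definition subcat_le C D : bool := `[< C `<=` D >].

Lemma subcat_lexx : reflexive subcat_le.
Proof. by move=> C; apply/asboolP. Qed.

Lemma subcat_le_anti : antisymmetric subcat_le.
Proof.
move=> C D /andP[/asboolP CD /asboolP DC].
by apply: closed_subcat_inj; apply/seteqP.
Qed.

Lemma subcat_le_trans : transitive subcat_le.
Proof.
move=> D C E /asboolP CD /asboolP DE; apply/asboolP.
exact: subset_trans CD DE.
Qed.

HB.instance Definition _ := Order.Le_isPOrder.Build subcat_display L
  subcat_lexx subcat_le_anti subcat_le_trans.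

Lemma subcat_leP C D : reflect (C `<=` D) (C <= D)%O.
Proof. exact: asboolP. Qed.

Definition subcat_inter (S : set L) : set (fgmod A) :=
  [set M | forall C, S C -> subcat_obj C M].

Lemma subcat_inter_subcat S : is_subcat (subcat_inter S).
Proof.
split=> [M M0 C _|M N MN CM C SC|X Y Z XY CX CY C SC|X Y Z XY CZ].
- exact: (subcat0 (subcatP C)).
- exact: (subcat_iso (subcatP C) MN (CM C SC)).
- exact: (subcat_dsum (subcatP C) XY (CX C SC) (CY C SC)).
- by split=> C SC; have [] := subcat_summand (subcatP C) XY (CZ C SC).
Qed.

Lemma subcat_inter_closed S M N :
  K M N -> subcat_inter S M -> subcat_inter S N.
Proof. by move=> MN CM C SC; apply: subcat_closed MN (CM C SC). Qed.

Definition subcat_inf (S : set L) : L :=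
  ClosedSubcat (subcat_inter_subcat S) (@subcat_inter_closed S).

Definition subcat_meet C D : L := subcat_inf [set C; D].
Definition subcat_join C D : L := subcat_inf [set E | C `<=` E /\ D `<=` E].

Lemma subcat_meetP C D E : (C <= subcat_meet D E)%O = (C <= D)%O && (C <= E)%O.
Proof.
apply/idP/andP => [/subcat_leP CDE|[/subcat_leP CD /subcat_leP CE]].
  by split; apply/subcat_leP => M /CDE; apply; [left|right].
by apply/subcat_leP => M CM _ [->|->]; [exact: CD|exact: CE].
Qed.

Lemma subcat_joinP C D E : (subcat_join C D <= E)%O = (C <= E)%O && (D <= E)%O.
Proof.
apply/idP/andP => [/subcat_leP CDE|[/subcat_leP CE /subcat_leP DE]].
  by split; apply/subcat_leP => M HM; apply: CDE => G [CG DG];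
    [exact: CG|exact: DG].
by apply/subcat_leP => M; apply.
Qed.

HB.instance Definition _ := Order.POrder_MeetJoin_isLattice.Build
  subcat_display L subcat_meetP subcat_joinP.

Definition subcat_size (C : L) : nat := #|` fset_set (ind A `&` C)|.

End SubcatLattice.

Definition Lquot (F : fieldType) (A : falgType F) :=
  closed_subcat (@is_factor F A).
Definition Lsub (F : fieldType) (A : falgType F) :=
  closed_subcat (@is_sub F A).

HB.instance Definition _ F A := Order.Lattice.on (@Lquot F A).
HB.instance Definition _ F A := Order.Lattice.on (@Lsub F A).

Definition chain_prod (r : nat) (c : 'I_r -> nat) :=
  {dffun forall i : 'I_r, 'I_(c i).+1}.

HB.instance Definition _ r c := Finite.on (@chain_prod r c).

Section ChainProd.
Context {r : nat} {c : 'I_r -> nat}.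
Local Notation T := (chain_prod c).
Implicit Types x y z : T.

Definition chain_le x y : bool := [forall i, (x i <= y i)%O].

Lemma chain_lexx : reflexive chain_le.
Proof. by move=> x; apply/forallP. Qed.

Lemma chain_le_anti : antisymmetric chain_le.
Proof.
move=> x y /andP[/forallP xy /forallP yx]; apply/ffunP => i.
by apply: le_anti; rewrite xy yx.
Qed.

Lemma chain_le_trans : transitive chain_le.
Proof.
by move=> y x z /forallP xy /forallP yz; apply/forallP => i; apply: le_trans (yz i).
Qed.

HB.instance Definition _ := Order.Le_isPOrder.Build chain_display T
  chain_lexx chain_le_anti chain_le_trans.

Definition chain_meet x y : T := [ffun i => Order.meet (x i) (y i)].
Definition chain_join x y : T := [ffun i => Order.join (x i) (y i)].

Lemma chain_meetP x y z : (x <= chain_meet y z)%O = (x <= y)%O && (x <= z)%O.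
Proof.
apply/forallP/andP => [xyz|[/forallP xy /forallP xz] i].
  by split; apply/forallP => i; have := xyz i; rewrite ffunE lexI => /andP[].
by rewrite ffunE lexI xy xz.
Qed.

Lemma chain_joinP x y z : (chain_join x y <= z)%O = (x <= z)%O && (y <= z)%O.
Proof.
apply/forallP/andP => [xyz|[/forallP xz /forallP yz] i].
  by split; apply/forallP => i; have := xyz i; rewrite ffunE leUx => /andP[].
by rewrite ffunE leUx xz yz.
Qed.

HB.instance Definition _ := Order.POrder_MeetJoin_isLattice.Build
  chain_display T chain_meetP chain_joinP.

Definition chain_grade x : nat := (\sum_(i < r) x i)%N.

End ChainProd.

Definition graded_lattice_iso (dT dU : Order.disp_t)
    (T : latticeType dT) (U : latticeType dU)
    (gT : T -> nat) (gU : U -> nat) : Prop :=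
  exists f : T -> U,
    [/\ bijective f,
        {morph f : x y / Order.meet x y},
        {morph f : x y / Order.join x y} &
        forall x, gU (f x) = gT x].

Definition rank_poly (T : choiceType) (g : T -> nat) : {poly int} :=
  \sum_(i \in [set: nat]) ((#|` fset_set [set x | g x = i]|)%:R : int) *: 'X^i.

Definition Rquot (F : fieldType) (A : falgType F) : {poly int} :=
  rank_poly (fun C : Lquot A => subcat_size C).
Definition Rsub (F : fieldType) (A : falgType F) : {poly int} :=
  rank_poly (fun C : Lsub A => subcat_size C).

Definition qint (a : nat) : {poly int} := \sum_(j < a) 'X^j.

(* Main.v *)
From HB Require Import structures.
Require Import Defs.
From mathcomp Require Import all_boot all_order all_algebra all_field.
From mathcomp Require Import perm finmap.
From mathcomp Require Import boolp classical_sets functions cardinality fsbigop.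

Set Implicit Arguments.
Unset Strict Implicit.
Unset Printing Implicit Defensive.

Import Order.TTheory GRing.Theory.
Local Open Scope ring_scope.

(** The point is that a Nakayama algebra has very few indecomposable modules:
    they are the nonzero factors of the P_i, and also the nonzero submodules of
    the I_i, and all of them are uniserial.

    Uniseriality [indecomposable_uniserial].  Among the uniserial submodules of
    a nonzero module M take one, N, of largest dimension.  Its socle is some
    S_i, so N embeds in the uniserial injective module I_i, and the embedding
    extends to a map f from M to I_i.  The image E of f is uniserial, hence a
    factor of some P_j; lifting P_j ->> E through M ->> E gives a map
    P_j -> M with uniserial image, so dim E <= dim N by the choice of N.  As N
    embeds in E, the composite N -> E is an isomorphism, M ->> E splits, and an
    indecomposable M is isomorphic to E.

    Classification.  The submodules of a uniserial module of length n are the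
    n + 1 terms of its composition series.  Hence the nonzero factors of P_i
    form one chain of c_i modules, of lengths 1, ..., c_i
    [factor_chain_family]; the chains for distinct i share no module because
    S_i is the unique simple factor of each member.  Dually, the nonzero
    submodules of I_i form a chain of d_i modules [sub_chain_family].

    Lattices [subcat_lattice_iso].  A closed subcategory is determined by its
    indecomposable members, as every module is a finite direct sum of
    indecomposables.  If a uniserial module is a factor (a submodule) of
    X + Y, then it is a factor (a submodule) of X or of Y, since its submodules
    are linearly ordered.  So any choice of an initial segment in each
    chain is the set of indecomposables of a closed subcategory, and a
    subcategory amounts to the vector of the sizes of these segments.

    Multisets.  For every l both #{i | c_i > l} and #{i | d_i > l} count the
    indecomposable modules of length l + 1 [chain_family_count_le], so c and d
    agree up to a permutation of the indices.  The polynomials are then read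
    off the product of chains [chain_prod_poly]. *)

(** * Submodules and quotients of row spaces *)
Section Linear.
Context {F : fieldType} {A : falgType F}.
Implicit Types M N K E : fgmod A.

Lemma linear_hom M N (f : M -> N) :
  linear f -> exists g : {linear M -> N}, g =1 f.
Proof.
move=> f_lin; pose Hf := GRing.isLinear.Build _ _ _ _ f f_lin.
pose g : {linear M -> N} := HB.pack f Hf.
by exists g.
Qed.

(** An element of the algebra that is a scalar acts as that scalar, so that
    homomorphisms and submodules are linear over the base field. *)
Lemma scale_scalar M (k : F) (x : M) :
  (k%:A : A^c) *: x = (k *: (x : 'rV_(fgmod_dim M)) : 'rV_(fgmod_dim M)).
Proof.
rewrite -[LHS]/((x : 'rV_(fgmod_dim M)) *m fgmod_act M k%:A).
have act0 : fgmod_act M 0 = 0.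
  have := fgmod_actP M (-1) 0 0; rewrite scaler0 addr0 scaleN1r.
  by rewrite addNr.
have := fgmod_actP M k 1 0; rewrite addr0 act0 addr0 fgmod_act1 => ->.
by rewrite -scalemxAr mulmx1.
Qed.

Lemma hom_mx M N (f : {linear M -> N}) :
  exists B : 'M[F]_(fgmod_dim M, fgmod_dim N),
    forall x : M, f x = (x : 'rV_(fgmod_dim M)) *m B.
Proof.
have fF : linear (f : 'rV[F]_(fgmod_dim M) -> 'rV[F]_(fgmod_dim N)).
  move=> k x y; rewrite -(scale_scalar (M := M) k x) -(scale_scalar (M := N)).
  exact: (linearP f).
pose Hf := GRing.isLinear.Build _ _ _ _ _ fF.
pose g : {linear 'rV[F]_(fgmod_dim M) -> 'rV[F]_(fgmod_dim N)} :=
  HB.pack (f : 'rV[F]_(fgmod_dim M) -> 'rV[F]_(fgmod_dim N)) Hf.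
by exists (lin1_mx g) => x; rewrite mul_rV_lin1.
Qed.

(** A row space of largest rank among those contained in U is all of U, since
    adding a vector of U to a smaller one would increase the rank. *)
Lemma submodule_mx M (U : {pred M}) : GRing.submod_closed U ->
  exists W : 'M[F]_(fgmod_dim M), forall x : M,
    (x \in U) = ((x : 'rV_(fgmod_dim M)) <= W)%MS.
Proof.
move=> [U0 Ul].
have UZ k (x : 'rV_(fgmod_dim M)) : (x : M) \in U -> ((k *: x) : M) \in U.
  move=> Ux; rewrite -[X in X \in U]addr0.
  have := Ul (k%:A : A^c) x 0 Ux U0; by rewrite (scale_scalar (M := M)).
have UD (x y : M) : x \in U -> y \in U -> x + y \in U.
  by move=> Ux Uy; have := Ul 1 x y Ux Uy; rewrite scale1r.
pose in_U (W : 'M[F]_(fgmod_dim M)) :=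
  forall x : 'rV_(fgmod_dim M), (x <= W)%MS -> (x : M) \in U.
pose Q m := `[< exists W, in_U W /\ \rank W = m >].
have exQ : exists m, Q m.
  exists 0%N; apply/asboolP; exists 0; split; last exact: mxrank0.
  by move=> x; rewrite submx0 => /eqP ->.
have Qle m : Q m -> (m <= fgmod_dim M)%N.
  by move=> /asboolP[W [_ <-]]; apply: rank_leq_row.
case: (ex_maxnP exQ Qle) => m /asboolP[W [UW rW]] maxm.
exists W => x; apply/idP/idP => [Ux|]; last exact: UW.
apply: contraT => xW.
have : Q (\rank (W + x)%MS).
  apply/asboolP; exists (W + (x : 'rV_(fgmod_dim M)))%MS; split=> // y.
  case/sub_addsmxP => [[u v]] /= ->; apply: (UD).
    by apply: UW; apply: submxMl.
  by rewrite [v]mx11_scalar mul_scalar_mx; apply: UZ.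
move/maxm; rewrite -rW leqNgt => /negP[]; apply: rank_ltmx.
by rewrite ltmxE addsmxSl addsmx_sub submx_refl.
Qed.

Lemma act_linear_mx M m p (B : 'M_(m, fgmod_dim M)) (C : 'M_(fgmod_dim M, p)) :
  linear (fun a : A => B *m fgmod_act M a *m C).
Proof.
move=> k a b /=; rewrite fgmod_actP mulmxDr mulmxDl.
by rewrite -scalemxAr -scalemxAl.
Qed.

Lemma submodule_stable M (U : {pred M}) (W : 'M[F]_(fgmod_dim M)) :
  GRing.submod_closed U ->
  (forall x : M, (x \in U) = ((x : 'rV_(fgmod_dim M)) <= W)%MS) ->
  forall a, (W *m fgmod_act M a <= W)%MS.
Proof.
move=> [U0 Ul] UW a; apply/row_subP => i; rewrite row_mul -UW.
have := Ul (a : A^c) (row i W) 0; rewrite addr0; apply=> //.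
by rewrite UW row_sub.
Qed.

(** B is a basis of the row space of W, and right multiplication by B' reads
    off the coordinates of a vector of that space. *)
Lemma row_basis_inverse n (W : 'M[F]_n) :
  exists (B : 'M[F]_(\rank W, n)) (B' : 'M[F]_(n, \rank W)),
    [/\ B *m B' = 1%:M, (B :=: W)%MS &
        forall m (X : 'M_(m, n)), (X <= W)%MS -> X *m B' *m B = X].
Proof.
exists (row_base W), (pinvmx (row_base W)).
split=> [||m X XW]; first exact/mulmxVp/row_base_free.
  exact: eq_row_base.
by apply: mulmxKpV; rewrite eq_row_base.
Qed.

(** C is a full-rank factor of the cokernel of W, so that right multiplication
    by C realises the quotient of the row space by W, and C' a section of it. *)
Lemma cokernel_projection n (W : 'M[F]_n) :
  exists q (C : 'M[F]_(n, q)) (C' : 'M[F]_(q, n)),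
    C' *m C = 1%:M /\
    forall m (X : 'M_(m, n)), (X *m C == 0) = (X <= W)%MS.
Proof.
set D := cokermx W; exists (\rank D), (col_base D), (pinvmx (col_base D)).
split=> [|m X]; first exact/mulVpmx/col_base_full.
rewrite submxE -/D; apply/eqP/eqP => [XC|XW].
  by rewrite -(mulmx_base D) mulmxA XC mul0mx.
have -> : col_base D = D *m pinvmx (row_base D).
  have := congr1 (mulmx^~ (pinvmx (row_base D))) (mulmx_base D).
  by rewrite -mulmxA mulmxVp ?row_base_free // mulmx1.
by rewrite mulmxA XW mul0mx.
Qed.

(** In the coordinates of a basis B of the stable row space, the action of a is
    the matrix X such that X B = B a. *)
Lemma submodule_embedding M (U : {pred M}) : GRing.submod_closed U ->
  exists N (i : {linear N -> M}),
    injective i /\ forall x, x \in U <-> exists y, i y = x.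
Proof.
move=> Ucl; have [W UW] := submodule_mx Ucl.
have Wst := submodule_stable Ucl UW.
have [B [B' [BK BW BV]]] := row_basis_inverse W.
have Bst a : (B *m fgmod_act M a <= W)%MS.
  by rewrite (submx_trans _ (Wst a)) // submxMr // BW.
pose act a := B *m fgmod_act M a *m B'.
have actB a : act a *m B = B *m fgmod_act M a by rewrite BV.
have actP : linear act by apply: act_linear_mx.
have act1 : act 1 = 1%:M by rewrite /act fgmod_act1 mulmx1.
have actM a b : act (a * b) = act a *m act b.
  by rewrite [act b]/act !mulmxA actB /act fgmod_actM !mulmxA.
pose N := FgMod actP act1 actM.
have [i iE] : exists i : {linear N -> M},
    i =1 (fun x : 'rV_(\rank W) => x *m B).
  apply: (linear_hom (M := N)) => a x y; rewrite -[LHS]/((x *m act a + y) *m B).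
  by rewrite mulmxDl -mulmxA actB mulmxA.
exists N, i; split=> [x y|x].
  rewrite !iE => /(congr1 (mulmx^~ B')).
  by rewrite -!mulmxA BK !mulmx1.
rewrite UW -BW; split=> [/submxP[y ->]|[y <-]]; first by exists y; rewrite iE.
by rewrite iE submxMl.
Qed.

(** The action of a on the quotient is computed on the representatives given
    by C'; it does not depend on them because the row space W is stable. *)
Lemma quotient_projection M (U : {pred M}) : GRing.submod_closed U ->
  exists N (p : {linear M -> N}),
    surjective p /\ forall x, x \in U <-> p x = 0.
Proof.
move=> Ucl; have [W UW] := submodule_mx Ucl.
have Wst := submodule_stable Ucl UW.
have [q [C [C' [CK CE]]]] := cokernel_projection W.
have C_act (x : 'rV_(fgmod_dim M)) a :
    x *m C = 0 -> x *m fgmod_act M a *m C = 0.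
  move=> /eqP; rewrite CE => xW; apply/eqP; rewrite CE.
  by rewrite (submx_trans _ (Wst a)) // submxMr.
pose act a := C' *m fgmod_act M a *m C.
have actC a : C *m act a = fgmod_act M a *m C.
  apply/row_matrixP => i; rewrite !rowE; set v := delta_mx _ _.
  apply/eqP; rewrite -subr_eq0; apply/eqP.
  have /(@C_act _ a) : (v *m C *m C' - v) *m C = 0.
    by rewrite mulmxBl -[X in X - _]mulmxA CK mulmx1 subrr.
  by rewrite !mulmxBl /act !mulmxA.
have actP : linear act by apply: act_linear_mx.
have act1 : act 1 = 1%:M by rewrite /act fgmod_act1 mulmx1.
have actM a b : act (a * b) = act a *m act b.
  by rewrite [act a]/act -!mulmxA actC /act fgmod_actM !mulmxA.
pose N := FgMod actP act1 actM.
have [p pE] : exists p : {linear M -> N},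
    p =1 (fun x : 'rV_(fgmod_dim M) => x *m C).
  apply: (linear_hom (N := N)) => a x y.
  rewrite -[RHS]/(x *m C *m act a + y *m C).
  rewrite -[LHS]/((x *m fgmod_act M a + y) *m C).
  by rewrite mulmxDl -mulmxA -actC mulmxA.
exists N, p; split=> [y|x]; last first.
  rewrite UW -CE pE; split=> [/eqP //|xC]; exact/eqP.
by exists ((y : 'rV_ _) *m C'); rewrite pE -mulmxA CK mulmx1.
Qed.

Lemma injective_dim M N (f : {linear M -> N}) : injective f ->
  (fgmod_dim M <= fgmod_dim N)%N /\
  ((fgmod_dim N <= fgmod_dim M)%N -> surjective f).
Proof.
move=> f_inj; have [B fE] := hom_mx f.
have Bfree : row_free B.
  rewrite -kermx_eq0; apply/eqP/row_matrixP => i; rewrite row0.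
  apply: (f_inj); rewrite !fE mul0mx -row_mul mulmx_ker; exact: row0.
have rB : \rank B = fgmod_dim M by apply/eqP.
split=> [|le y]; first by rewrite -rB rank_leq_col.
have Bfull : row_full B by rewrite /row_full eqn_leq rank_leq_col rB.
by exists ((y : 'rV_ _) *m pinvmx B); rewrite fE -mulmxA mulVpmx // mulmx1.
Qed.

Lemma surjective_dim M N (f : {linear M -> N}) : surjective f ->
  (fgmod_dim N <= fgmod_dim M)%N /\
  ((fgmod_dim M <= fgmod_dim N)%N -> injective f).
Proof.
move=> f_surj; have [B fE] := hom_mx f.
have Bfull : row_full B.
  rewrite -sub1mx; apply/row_subP => i.
  by have [x] := f_surj (row i 1%:M); rewrite fE => <-; apply: submxMl.
have rB : \rank B = fgmod_dim N by apply/eqP.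
split=> [|le x y]; first by rewrite -rB rank_leq_row.
have Bfree : row_free B by rewrite /row_free eqn_leq rank_leq_row rB.
by rewrite !fE => /(row_free_inj Bfree).
Qed.
End Linear.

(** * Homomorphisms and direct sums *)
Section Homs.
Context {F : fieldType} {A : falgType F}.
Implicit Types M N K E X Y Z : fgmod A.

Definition im_pred M N (f : {linear M -> N}) (U : {pred M}) : {pred N} :=
  [pred y | `[< exists2 x, x \in U & f x = y >]].

Lemma im_predP M N (f : {linear M -> N}) (U : {pred M}) y :
  reflect (exists2 x, x \in U & f x = y) (y \in im_pred f U).
Proof. by rewrite inE; apply: asboolP. Qed.

Lemma mem_im M N (f : {linear M -> N}) (U : {pred M}) x :
  x \in U -> f x \in im_pred f U.
Proof. by move=> Ux; apply/im_predP; exists x. Qed.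

Definition preim_pred M N (f : {linear M -> N}) (V : {pred N}) : {pred M} :=
  [pred x | f x \in V].

Definition ker_pred M N (f : {linear M -> N}) : {pred M} := [pred x | f x == 0].

Lemma im_closed M N (f : {linear M -> N}) (U : {pred M}) :
  GRing.submod_closed U -> GRing.submod_closed (im_pred f U).
Proof.
move=> [U0 Ul]; split=> [|a _ _ /im_predP[x Ux <-] /im_predP[y Uy <-]].
  by apply/im_predP; exists 0; rewrite ?linear0.
by apply/im_predP; exists (a *: x + y); [exact: Ul|rewrite linearP].
Qed.

Lemma preim_closed M N (f : {linear M -> N}) (V : {pred N}) :
  GRing.submod_closed V -> GRing.submod_closed (preim_pred f V).
Proof.
move=> [V0 Vl]; split=> [|a x y]; rewrite !inE ?linear0 // => Vx Vy.
by rewrite linearP; apply: Vl.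
Qed.

Lemma ker_closed M N (f : {linear M -> N}) : GRing.submod_closed (ker_pred f).
Proof.
split=> [|a x y]; rewrite !inE ?linear0 // => /eqP fx /eqP fy.
by rewrite linearP fx fy scaler0 addr0.
Qed.

Lemma predT_closed M : GRing.submod_closed (predT : {pred M}).
Proof. by []. Qed.

Lemma hom_injective M N (f : {linear M -> N}) :
  (forall x, f x = 0 -> x = 0) -> injective f.
Proof.
move=> f0 x y fxy; apply/eqP; rewrite -subr_eq0; apply/eqP/f0.
by rewrite linearB fxy subrr.
Qed.

Lemma injective_eq0 M N (f : {linear M -> N}) x :
  injective f -> f x = 0 -> x = 0.
Proof. by move=> f_inj fx; apply: f_inj; rewrite fx linear0. Qed.

Lemma factor_through M N K (f : {linear M -> N}) (g : {linear M -> K}) :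
  surjective f -> (forall x, f x = 0 -> g x = 0) ->
  exists h : {linear N -> K}, forall x, h (f x) = g x.
Proof.
move=> f_surj fg; have [s sK] := choice f_surj.
have sE x : g (s (f x)) = g x.
  apply/eqP; rewrite -subr_eq0 -linearB; apply/eqP/fg.
  by rewrite linearB sK subrr.
have [h hE] : exists h : {linear N -> K}, h =1 g \o s.
  apply: linear_hom => a x y /=.
  by rewrite -linearP -[RHS]sE linearP !sK.
by exists h => x; rewrite hE /= sE.
Qed.

Lemma lift_through M N K (f : {linear N -> M}) (g : {linear K -> M}) :
  injective f -> (forall x, exists y, f y = g x) ->
  exists h : {linear K -> N}, forall x, f (h x) = g x.
Proof.
move=> f_inj fg; have [s sK] := choice fg.
have [h hE] : exists h : {linear K -> N}, h =1 s.
  by apply: linear_hom => a x y; apply: f_inj; rewrite linearP !sK linearP.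
by exists h => x; rewrite hE sK.
Qed.

Lemma image_factorization M N (f : {linear M -> N}) :
  exists E (e : {linear M -> E}) (i : {linear E -> N}),
    [/\ surjective e, injective i & forall x, i (e x) = f x].
Proof.
have [E [i [i_inj iE]]] := submodule_embedding (im_closed f (predT_closed M)).
have [x|e eE] := lift_through (g := f) i_inj.
  by apply/iE/im_predP; exists x.
exists E, e, i; split=> // y.
have /im_predP[x _ fx] : i y \in im_pred f predT by apply/iE; exists y.
by exists x; apply: i_inj; rewrite eE.
Qed.

Lemma kernel_embedding M N (f : {linear M -> N}) :
  exists K (k : {linear K -> M}),
    injective k /\ forall x, f x = 0 <-> exists y, k y = x.
Proof.
have [K [k [k_inj kE]]] := submodule_embedding (ker_closed f).
by exists K, k; split=> // x; rewrite -kE inE; split=> /eqP.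
Qed.

Lemma bij_iso M N (f : {linear M -> N}) :
  injective f -> surjective f -> iso M N.
Proof.
move=> f_inj f_surj; have [g gK] := choice f_surj.
by exists f, g => // x; apply: f_inj; rewrite gK.
Qed.

Lemma isoP M N : iso M N ->
  exists (f : {linear M -> N}) (g : {linear N -> M}), cancel f g /\ cancel g f.
Proof.
move=> [f [g fK gK]].
have [|g' gE] := linear_hom (f := g).
  by move=> a x y; apply: (can_inj fK); rewrite linearP !gK.
by exists f, g'; split=> x; rewrite gE.
Qed.

Lemma iso_refl M : iso M M.
Proof. by exists idfun, id. Qed.

Lemma iso_sym M N : iso M N -> iso N M.
Proof. by move=> /isoP[f [g [fK gK]]]; exists g, f. Qed.

Lemma iso_trans M N K : iso M N -> iso N K -> iso M K.
Proof.
move=> [f [f' fK f'K]] [g [g' gK g'K]].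
by exists (g \o f), (f' \o g') => x /=; rewrite ?gK ?fK ?f'K ?g'K.
Qed.

Lemma dsum_homs Z X Y : lmod_iso Z (X * Y)%type ->
  exists (p : {linear Z -> X}) (q : {linear Z -> Y})
         (i : {linear X -> Z}) (j : {linear Y -> Z}),
    [/\ cancel i p, cancel j q, forall x, q (i x) = 0, forall y, p (j y) = 0 &
        forall z, z = i (p z) + j (q z)].
Proof.
move=> [f [g fK gK]].
have [|p pE] := linear_hom (f := fun z => (f z).1).
  by move=> a x y; rewrite linearP.
have [|q qE] := linear_hom (f := fun z => (f z).2).
  by move=> a x y; rewrite linearP.
have [|i iE] := linear_hom (f := fun x : X => g (x, 0 : Y) : Z).
  move=> a x y; apply: (can_inj fK); rewrite linearP !gK.
  by congr (_, _); rewrite /= scaler0 addr0.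
have [|j jE] := linear_hom (f := fun y : Y => g (0 : X, y) : Z).
  move=> a x y; apply: (can_inj fK); rewrite linearP !gK.
  by congr (_, _); rewrite /= scaler0 addr0.
exists p, q, i, j; split=> x; rewrite ?pE ?qE ?iE ?jE ?gK //.
apply: (can_inj fK); rewrite linearD !gK; case: (f x) => u v.
by congr (_, _); rewrite /= ?addr0 ?add0r.
Qed.

(** A split surjection exhibits M as the sum of its target and of its kernel,
    through x |-> (e x, x - s (e x)). *)
Lemma split_surjection_dsum M E (e : {linear M -> E}) (s : {linear E -> M}) :
  cancel s e ->
  exists K (k : {linear K -> M}),
    [/\ lmod_iso M (E * K)%type, injective k &
        forall x, e x = 0 <-> exists y, k y = x].
Proof.
move=> sK; have [K [k [k_inj kE]]] := kernel_embedding e.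
have [|r rE] := linear_hom (f := fun x : M => x - s (e x)).
  by move=> a x y; rewrite (linearP e) (linearP s) scalerBr opprD addrACA.
have [x|t tE] := lift_through (g := r) k_inj.
  by apply/kE; rewrite rE linearB sK subrr.
have ek y : e (k y) = 0 by apply/kE; exists y.
have f_lin : linear ((fun x : M => (e x, t x)) : M -> (E * K)%type).
  by move=> a x y; rewrite !linearP.
pose Hf := GRing.isLinear.Build _ _ _ _ _ f_lin.
pose f : {linear M -> (E * K)%type} :=
  HB.pack ((fun x : M => (e x, t x)) : M -> (E * K)%type) Hf.
exists K, k; split=> //; exists f, (fun z => s z.1 + k z.2) => [x|[u v]] /=.
  by rewrite tE rE addrC subrK.
congr (_, _); first by rewrite linearD sK ek addr0.
by apply: k_inj; rewrite tE rE linearD sK ek addr0 addrC addKr.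
Qed.
End Homs.

(** * Simple and uniserial modules *)
Section Uniserial.
Context {F : fieldType} {A : falgType F}.
Implicit Types M N K E S T X Y Z : fgmod A.

Lemma uniserial_sub M N (i : {linear N -> M}) :
  injective i -> uniserial M -> uniserial N.
Proof.
move=> i_inj uM U V Ucl Vcl.
by case: (uM _ _ (im_closed i Ucl) (im_closed i Vcl)) => UV; [left|right] => x;
  move=> /(mem_im i)/UV/im_predP[y Vy /i_inj <-].
Qed.

Lemma uniserial_factor M N (p : {linear M -> N}) :
  surjective p -> uniserial M -> uniserial N.
Proof.
move=> p_surj uM U V Ucl Vcl.
case: (uM _ _ (preim_closed p Ucl) (preim_closed p Vcl)) => UV;
  [left|right] => y Uy; have [x xy] := p_surj y;
  by have := UV x; rewrite !inE xy; apply.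
Qed.

Lemma iso_zero M N : iso M N -> zero_mod M -> zero_mod N.
Proof.
by move=> /isoP[f [g [fK gK]]] M0 y; rewrite -[y]gK (M0 (g y)) linear0.
Qed.

Lemma nonzero_mod M : ~ zero_mod M -> exists x : M, x <> 0.
Proof. by move=> /existsNP. Qed.

Lemma comparable_kernels M X Y (f : {linear M -> X}) (g : {linear M -> Y}) :
  uniserial M ->
  (forall x, f x = 0 -> g x = 0) \/ (forall x, g x = 0 -> f x = 0).
Proof.
move=> uM; case: (uM _ _ (ker_closed f) (ker_closed g)) => fg;
  [left|right] => x /eqP x0; by apply/eqP/(fg x).
Qed.

Lemma comparable_images M X Y (f : {linear X -> M}) (g : {linear Y -> M}) :
  uniserial M ->
  (forall x, exists y, g y = f x) \/ (forall y, exists x, f x = g y).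
Proof.
have fcl := im_closed f (predT_closed X).
have gcl := im_closed g (predT_closed Y).
move=> uM; case: (uM _ _ fcl gcl) => fg; [left|right] => x.
  by have /fg/im_predP[y _ yx] := mem_im f (isT : x \in predT); exists y.
by have /fg/im_predP[y _ yx] := mem_im g (isT : x \in predT); exists y.
Qed.

(** The images of X and of Y in N add up to N and are comparable, hence the
    larger one is N. *)
Lemma dsum_factor_uniserial Z X Y N (f : {linear Z -> N}) :
  lmod_iso Z (X * Y)%type -> uniserial N -> surjective f ->
  is_factor X N \/ is_factor Y N.
Proof.
move=> /dsum_homs[p [q [i [j [_ _ _ _ Zpq]]]]] uN f_surj.
pose fi : {linear X -> N} := f \o i; pose fj : {linear Y -> N} := f \o j.
case: (comparable_images fi fj uN) => /= fij.
  right; exists fj => y; have [z <-] := f_surj y.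
  have [y' y'E] := fij (p z); exists (y' + q z) => /=.
  by rewrite (linearD j) (linearD f) y'E -(linearD f) -Zpq.
left; exists fi => y; have [z <-] := f_surj y.
have [x' x'E] := fij (q z); exists (p z + x') => /=.
by rewrite (linearD i) (linearD f) x'E -(linearD f) -Zpq.
Qed.

(** The kernels of N -> X and N -> Y intersect in 0 and are comparable, hence
    the smaller one is 0. *)
Lemma dsum_sub_uniserial Z X Y N (f : {linear N -> Z}) :
  lmod_iso Z (X * Y)%type -> uniserial N -> injective f ->
  is_sub X N \/ is_sub Y N.
Proof.
move=> /dsum_homs[p [q [i [j [_ _ _ _ Zpq]]]]] uN f_inj.
have f0 x : p (f x) = 0 -> q (f x) = 0 -> x = 0.
  move=> px qx; apply: (injective_eq0 f_inj).
  by rewrite (Zpq (f x)) px qx !linear0 addr0.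
pose pf : {linear N -> X} := p \o f; pose qf : {linear N -> Y} := q \o f.
case: (comparable_kernels pf qf uN) => fpq.
  by left; exists pf; apply: hom_injective => x px; apply: f0 => //; apply: fpq.
by right; exists qf; apply: hom_injective => x qx; apply: f0 => //; apply: fpq.
Qed.

Lemma uniserial_indecomposable M :
  uniserial M -> ~ zero_mod M -> indecomposable M.
Proof.
move=> uM M0; split=> // X Y /dsum_homs[p [q [i [j [ip jq qi pj _]]]]].
case: (comparable_images i j uM) => ij.
  by left=> x; have [y yx] := ij x; rewrite -(ip x) -yx pj.
by right=> y; have [x xy] := ij y; rewrite -(jq y) -xy qi.
Qed.

Lemma simple_hom_injective S N (f : {linear S -> N}) :
  simple_mod S -> (exists x, f x <> 0) -> injective f.
Proof.
move=> [_ simS] [x fx]; apply: hom_injective => y fy.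
case: (simS _ (ker_closed f)) => kerE.
  by apply/eqP; have := kerE y; rewrite !inE fy eqxx.
by case: fx; apply/eqP; have := kerE x; rewrite !inE.
Qed.

Lemma simple_hom_surjective S M (f : {linear M -> S}) :
  simple_mod S -> (exists x, f x <> 0) -> surjective f.
Proof.
move=> [_ simS] [x fx] y.
case: (simS _ (im_closed f (predT_closed M))) => imE.
  by case: fx; apply/eqP; have := imE (f x); rewrite (mem_im f) // inE.
have : y \in im_pred f predT by rewrite imE.
by case/im_predP => x' _; exists x'.
Qed.

Lemma nonsimple_submodule M : ~ zero_mod M -> ~ simple_mod M ->
  exists U : {pred M}, [/\ GRing.submod_closed U,
    exists2 x, x \in U & x <> 0 & exists x, x \notin U].
Proof.
move=> M0 nsM; apply: contrapT => noU; apply: nsM; split=> // U Ucl.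
have [U0|/existsNP[x /not_implyP[Ux x0]]] :=
  pselect (forall x, x \in U -> x = 0).
  left=> x; rewrite !inE; apply/idP/eqP => [|->]; [exact: U0|by case: Ucl].
right=> y; rewrite inE; apply: contrapT => yU; apply: noU; exists U; split=> //.
  by exists x.
by exists y; apply/negP => Uy; apply: yU.
Qed.

Lemma has_simple_sub M : ~ zero_mod M -> exists2 S, simple_mod S & is_sub M S.
Proof.
have [n] := ubnP (fgmod_dim M); elim: n M => // n IHn M /ltnSE Mn M0.
have [sM|nsM] := pselect (simple_mod M); first by exists M => //; exists idfun.
have [U [Ucl [x Ux x0] [y yU]]] := nonsimple_submodule M0 nsM.
have [N [i [i_inj iE]]] := submodule_embedding Ucl.
have ltNM : (fgmod_dim N < fgmod_dim M)%N.
  rewrite ltnNge; apply/negP => le.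
  have [_ /(_ le y)[z zy]] := injective_dim i_inj.
  by move/negP: yU; apply; apply/iE; exists z.
have N0 : ~ zero_mod N.
  by move/iE: Ux => [z zx] N0; apply: x0; rewrite -zx (N0 z) linear0.
have [S sS [j j_inj]] := IHn N (leq_trans ltNM Mn) N0.
by exists S => //; exists (i \o j : {linear _ -> _}); apply: inj_comp.
Qed.

Lemma surjective_comp M N K (f : {linear N -> K}) (g : {linear M -> N}) :
  surjective f -> surjective g -> surjective (f \o g).
Proof.
move=> f_surj g_surj z; have [y <-] := f_surj z.
by have [x <-] := g_surj y; exists x.
Qed.

Lemma has_simple_factor M :
  ~ zero_mod M -> exists2 S, simple_mod S & is_factor M S.
Proof.
have [n] := ubnP (fgmod_dim M); elim: n M => // n IHn M /ltnSE Mn M0.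
have [sM|nsM] := pselect (simple_mod M).
  by exists M => //; exists idfun => x; exists x.
have [U [Ucl [x Ux x0] [y yU]]] := nonsimple_submodule M0 nsM.
have [N [p [p_surj pE]]] := quotient_projection Ucl.
have ltNM : (fgmod_dim N < fgmod_dim M)%N.
  rewrite ltnNge; apply/negP => le.
  have [_ /(_ le) p_inj] := surjective_dim p_surj.
  by apply/x0/p_inj; rewrite linear0; apply/pE.
have N0 : ~ zero_mod N.
  by move=> N0; move/negP: yU; apply; apply/pE/N0.
have [S sS [q q_surj]] := IHn N (leq_trans ltNM Mn) N0.
by exists S => //; exists (q \o p : {linear _ -> _}); apply: surjective_comp.
Qed.

(** In a decomposition of P the cover P -> S is nonzero on one summand, and
    that summand is then all of P. *)
Lemma cover_indecomposable P S :
  simple_mod S -> projective_cover P S -> indecomposable P.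
Proof.
move=> sS [_ [p [p_surj supp]]].
have [x0 x0N] := nonzero_mod sS.1.
split=> [P0|X Y /dsum_homs[u [v [i [j [iu jv vi uj Puv]]]]]].
  by have [x px] := p_surj x0; apply: x0N; rewrite -px (P0 x) linear0.
(* A summand T on which p is nonzero maps onto S, hence is all of P by
   superfluity of the kernel of p. *)
have surj_case (T W : fgmod A) (k : {linear T -> P}) (w : {linear P -> W})
    (l : {linear W -> P}) : cancel l w -> (forall x, w (k x) = 0) ->
    (exists x, p (k x) <> 0) -> zero_mod W.
  move=> lw wk pk; pose pk' : {linear T -> S} := p \o k.
  have pk_surj := simple_hom_surjective (f := pk') sS pk.
  move=> y; have kT : im_pred k predT =i predT.
    apply: supp; first exact: im_closed (predT_closed T).
    move=> x; have [t ptx] := pk_surj (p x); exists (k t), (x - k t).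
    by split; [exact: mem_im|rewrite linearB -ptx subrr|rewrite addrC subrK].
  have /im_predP[t _ tl] : l y \in im_pred k predT by rewrite kT.
  by rewrite -(lw y) -tl wk.
have [pi|/existsNP pi] := pselect (forall x, p (i x) = 0); last first.
  by right; apply: surj_case jv vi pi.
left; apply: surj_case iu uj _; apply: contrapT => /forallNP pj.
have [z pz] := p_surj x0; apply: x0N; rewrite -pz (Puv z) linearD pi add0r.
by apply: contrapT; apply: pj.
Qed.

(** In a decomposition of I one of the projections is nonzero on S, hence
    injective, and the other summand vanishes. *)
Lemma envelope_indecomposable I S :
  simple_mod S -> injective_envelope I S -> indecomposable I.
Proof.
move=> sS [_ [s [s_inj ess]]].
have [x0 x0N] := nonzero_mod sS.1.
split=> [I0|X Y /dsum_homs[u [v [i [j [iu jv vi uj Iuv]]]]]].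
  by apply/x0N/s_inj; rewrite linear0; apply: I0.
(* A projection w that is nonzero on S is injective on S, hence on I by
   essentiality of S. *)
have inj_case (T W : fgmod A) (w : {linear I -> W}) (k : {linear T -> I})
    (l : {linear I -> T}) : cancel k l -> (forall x, w (k x) = 0) ->
    (exists x, w (s x) <> 0) -> zero_mod T.
  move=> kl wk ws t; pose ws' : {linear S -> W} := w \o s.
  have ws_inj := simple_hom_injective (f := ws') sS ws.
  suff /(_ (k t)) : ker_pred w =i pred1 0.
    rewrite !inE wk eqxx => /esym/eqP kt0; exact: (injective_eq0 (can_inj kl)).
  apply: ess => [|x]; first exact: ker_closed.
  rewrite !inE => /eqP wsx; rewrite (injective_eq0 ws_inj (x := x)) ?linear0 //.
have [us|/existsNP us] := pselect (forall x, u (s x) = 0); last first.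
  by right; apply: inj_case jv uj us.
left; apply: inj_case iu vi _; apply: contrapT => /forallNP vs.
apply/x0N/(injective_eq0 s_inj); rewrite (Iuv (s x0)) us linear0 add0r.
suff -> : v (s x0) = 0 by rewrite linear0.
by apply: contrapT; apply: vs.
Qed.
End Uniserial.

(** * Indecomposable modules over a Nakayama algebra *)
Section Nakayama.
Context {F : fieldType} {A : falgType F} {r : nat}.
Context {S P I : 'I_r -> fgmod A}.
Hypotheses (hA : nakayama A) (hS : forall i, simple_mod (S i)).
Hypothesis hS_neq : forall i j, iso (S i) (S j) -> i = j.
Hypothesis hS_all : forall M : fgmod A, simple_mod M -> exists i, iso M (S i).
Hypothesis hP : forall i, projective_cover (P i) (S i).
Hypothesis hI : forall i, injective_envelope (I i) (S i).
Implicit Types M N K E T X Y Z : fgmod A.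

Lemma cover_uniserial i : uniserial (P i).
Proof.
apply: hA; first exact: cover_indecomposable (hS i) (hP i).
by left; case: (hP i).
Qed.

Lemma envelope_uniserial i : uniserial (I i).
Proof.
apply: hA; first exact: envelope_indecomposable (hS i) (hI i).
by right; case: (hI i).
Qed.

(** N has a simple factor T, isomorphic to some S_i, and P_i ->> T lifts to a
    map P_i -> N.  Its image is not contained in the kernel of N ->> T, hence
    contains that kernel, and it maps onto T: it is N. *)
Lemma uniserial_factor_cover N :
  uniserial N -> ~ zero_mod N -> exists i, is_factor (P i) N.
Proof.
move=> uN N0; have [T sT [q q_surj]] := has_simple_factor N0.
have [i /isoP[f [g [fK gK]]]] := hS_all sT; exists i.
have [projP [p [p_surj _]]] := hP i.
have [k kE] := projP _ _ q (g \o p : {linear _ -> _}) q_surj; exists k.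
case: (uN _ _ (im_closed k (predT_closed _)) (ker_closed q)) => [imk|kerq].
  case: sT.1 => t; rewrite -[t]fK; have [x <-] := p_surj (f t).
  by have := imk _ (mem_im k (isT : x \in predT)); rewrite inE kE => /eqP.
move=> y; have [x xE] := p_surj (f (q y)).
have /im_predP[z _ zE] : y - k x \in im_pred k predT.
  by apply: kerq; rewrite inE linearB kE /= xE fK subrr.
by exists (z + x); rewrite linearD zE subrK.
Qed.

(** N has a simple submodule T, isomorphic to some S_i, and T >-> I_i extends to
    N.  The kernel of the extension does not contain T, hence is contained in
    it, and the extension is injective on T. *)
Lemma uniserial_sub_envelope N :
  uniserial N -> ~ zero_mod N -> exists i, is_sub (I i) N.
Proof.
move=> uN N0; have [T sT [j j_inj]] := has_simple_sub N0.
have [i /isoP[f [g [fK gK]]]] := hS_all sT; exists i.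
have [injI [s [s_inj _]]] := hI i.
have [k kE] := injI _ _ j (s \o f : {linear _ -> _}) j_inj; exists k.
have kj0 t : k (j t) = 0 -> t = 0.
  by rewrite kE /= => /(injective_eq0 s_inj)/(injective_eq0 (can_inj fK)).
case: (uN _ _ (im_closed j (predT_closed _)) (ker_closed k)) => [imj|kerk].
  case: sT.1 => t; apply: kj0.
  by have := imj _ (mem_im j (isT : t \in predT)); rewrite inE => /eqP.
apply: hom_injective => x kx; have /kerk/im_predP[t _ tx] : x \in ker_pred k.
  by rewrite inE kx.
by rewrite -tx (kj0 t) ?linear0 // tx.
Qed.

Lemma maximal_uniserial_sub M : ~ zero_mod M ->
  exists N, [/\ is_sub M N, uniserial N, ~ zero_mod N &
    forall N', is_sub M N' -> uniserial N' -> (fgmod_dim N' <= fgmod_dim N)%N].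
Proof.
move=> M0; pose Q n := `[< exists N, [/\ is_sub M N, uniserial N, ~ zero_mod N &
  fgmod_dim N = n] >].
have exQ : exists n, Q n.
  have [T sT T_sub] := has_simple_sub M0.
  exists (fgmod_dim T); apply/asboolP; exists T; split=> //; last exact: sT.1.
  move=> U V Ucl Vcl; case: (sT.2 U Ucl) => UE; [left|right] => x.
    by rewrite UE inE => /eqP ->; case: Vcl.
  by rewrite UE.
have Qle n : Q n -> (n <= fgmod_dim M)%N.
  by case/asboolP => N [[i i_inj] _ _ <-]; case: (injective_dim i_inj).
case: (ex_maxnP exQ Qle) => n /asboolP[N [N_sub uN N0 dimN]] maxn.
exists N; split=> // N' N'_sub uN'; rewrite dimN.
have [N'0|N'0] := pselect (zero_mod N'); last first.
  by apply: maxn; apply/asboolP; exists N'.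
case: N'_sub => i' _.
have z_inj : injective (\0 : {linear N' -> N}).
  by apply: hom_injective => x _; apply: N'0.
by rewrite -dimN; case: (injective_dim z_inj).
Qed.

(** The maximal uniserial submodule N of M turns out to be a direct summand: it
    maps isomorphically onto the image E of an extension to M of the embedding
    of N in an injective envelope.  This is where both halves of the Nakayama
    condition are used, the injective one to make E uniserial and the
    projective one to compare dim E with dim N. *)
Theorem indecomposable_uniserial M : indecomposable M -> uniserial M.
Proof.
move=> [M0 M_indec].
have [N [[u u_inj] uN N0 maxN]] := maximal_uniserial_sub M0.
have [i [j j_inj]] := uniserial_sub_envelope uN N0.
have [f fE] := (hI i).1 _ _ u j u_inj.
have [E [e [c [e_surj c_inj ceE]]]] := image_factorization f.
have uE : uniserial E := uniserial_sub c_inj (@envelope_uniserial i).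
have eu_inj : injective (e \o u).
  by move=> x y /= /(congr1 c); rewrite !ceE !fE; apply: j_inj.
have [n n0] := nonzero_mod N0.
have E0 : ~ zero_mod E.
  move=> E0; apply/n0/eu_inj; rewrite linear0; exact: E0.
have [l [p p_surj]] := uniserial_factor_cover uE E0.
have [g gE] := (hP l).1 _ _ e p e_surj.
(* The image N' of the lift of P_l to M is uniserial, and maps onto E. *)
have [N' [q [v [q_surj v_inj vqE]]]] := image_factorization g.
have uN' := uniserial_factor q_surj (@cover_uniserial l).
have N'_max := maxN N' (ex_intro _ v v_inj) uN'.
have ev_surj : surjective (e \o v).
  by move=> y; have [x <-] := p_surj y; exists (q x); rewrite /= vqE gE.
have dimE := (surjective_dim (f := e \o v : {linear _ -> _}) ev_surj).1.
have eu_surj := (injective_dim (f := e \o u : {linear _ -> _}) eu_inj).2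
  (leq_trans dimE N'_max).
(* The section is the inverse of e u followed by u. *)
have [|s sE] := factor_through (g := u) eu_surj.
  by move=> x /= eux; rewrite (eu_inj x 0) ?linear0.
have sK : cancel s e by move=> y; have [x <-] := eu_surj y; rewrite sE.
have [K [k [M_EK k_inj kE]]] := split_surjection_dsum sK.
case: (M_indec _ _ M_EK) => [/E0 //|K0].
apply: (uniserial_sub _ uE); apply: hom_injective => x /kE[y <-].
by rewrite (K0 y) linear0.
Qed.
End Nakayama.

(** * Composition series of uniserial modules *)
Section CompositionSeries.
Context {F : fieldType} {A : falgType F}.
Implicit Types M N P : fgmod A.

Definition composition_series M n (U : nat -> {pred M}) : Prop :=
  [/\ forall k, (k <= n)%N -> GRing.submod_closed (U k),
      U 0%N =i pred1 0, U n =i predT &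
      forall k, (k < n)%N -> simple_factor (U k) (U k.+1)].

Lemma series_mono M n (U : nat -> {pred M}) k l :
  composition_series n U -> (k <= l <= n)%N -> {subset U k <= U l}.
Proof.
move=> [_ _ _ U_simple] /andP[]; elim: l => [|l IHl].
  by rewrite leqn0 => /eqP -> _ x.
rewrite leq_eqVlt => /predU1P[-> _ x //|kl] ln x /(IHl kl (ltnW ln)).
by have [UU _ _] := U_simple l ln; apply: UU.
Qed.

(** Take the last term U k of the series contained in W.  The next term is not
    contained in W, hence contains it, and U k <= W < U (k + 1) forces
    W = U k. *)
Lemma series_submodule M n (U : nat -> {pred M}) (W : {pred M}) :
  uniserial M -> composition_series n U -> GRing.submod_closed W ->
  exists2 k, (k <= n)%N & W =i U k.
Proof.
move=> uM [Ucl U0 Un U_simple] Wcl.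
pose Q k := (k <= n)%N && `[< {subset U k <= W} >].
have exQ : exists k, Q k.
  exists 0%N; apply/andP; split=> //; apply/asboolP => x.
  rewrite U0 inE => /eqP ->.
  by case: Wcl.
have Qle k : Q k -> (k <= n)%N by case/andP.
case: (ex_maxnP exQ Qle) => k /andP[kn /asboolP UkW] maxk; exists k => // x.
apply/idP/idP; last exact: UkW.
move: kn; rewrite leq_eqVlt => /predU1P[-> _|kn]; first by rewrite Un.
have WU : {subset W <= U k.+1}.
  case: (uM _ _ Wcl (Ucl _ kn)) => // UW.
  have /maxk : Q k.+1 by apply/andP; split=> //; apply/asboolP.
  by rewrite ltnn.
have [_ _ /(_ W Wcl UkW WU)[|UW]] := U_simple k kn; first exact.
have /maxk : Q k.+1 by apply/andP; split=> //; apply/asboolP.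
by rewrite ltnn.
Qed.

(** Two composition series of a uniserial module agree term by term: if they
    agree at k, the comparable terms at k + 1 cover the same submodule. *)
Lemma composition_length_le M n m :
  uniserial M -> composition_length M n -> composition_length M m -> (n <= m)%N.
Proof.
move=> uM [U Us] [V Vs]; rewrite leqNgt; apply/negP => mn.
have [Ucl U0 Un U_simple] := Us; have [Vcl V0 Vm V_simple] := Vs.
have UV k : (k <= m)%N -> U k =i V k.
  elim: k => [|k IHk] km; first by move=> x; rewrite U0 V0.
  have {}IHk := IHk (ltnW km); have kn := leq_trans km (ltnW mn).
  have [UU nUU Umin] := U_simple k kn; have [VV nVV Vmin] := V_simple k km.
  case: (uM _ _ (Ucl _ kn) (Vcl _ km)) => [UV|VU] x; apply/idP/idP; auto.
    case: (Vmin _ (Ucl _ kn)) => //; first by move=> y; rewrite -IHk; apply: UU.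
      by move=> UVk; case: nUU => y /UVk; rewrite IHk.
    exact.
  case: (Umin _ (Vcl _ km)) => //; first by move=> y; rewrite IHk; apply: VV.
    by move=> VUk; case: nVV => y /VUk; rewrite IHk.
  exact.
have [_ nUU _] := U_simple m mn; apply: nUU => x _.
by rewrite UV // Vm.
Qed.

Lemma composition_length_unique M n m :
  uniserial M -> composition_length M n -> composition_length M m -> n = m.
Proof.
by move=> uM Mn Mm; apply/eqP; rewrite eqn_leq !(composition_length_le uM).
Qed.

Lemma composition_length_nonzero M n :
  composition_length M n.+1 -> ~ zero_mod M.
Proof.
move=> [U [Ucl U0 _ /(_ 0%N isT)[_ nUU _]]] M0; apply: nUU => x _.
by rewrite U0 inE (M0 x).
Qed.

(** The images of the terms from the kernel U k on form a composition series of
    the factor. *)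
Lemma factor_series M N n (U : nat -> {pred M}) (p : {linear M -> N}) k :
  composition_series n U -> (k <= n)%N -> surjective p ->
  (forall x, p x = 0 <-> x \in U k) -> composition_length N (n - k).
Proof.
move=> Us kn p_surj pE; have [Ucl U0 Un U_simple] := Us.
have imU a x : (k <= a <= n)%N -> p x \in im_pred p (U a) -> x \in U a.
  move=> kan /im_predP[y Uy yx]; have /andP[_ an] := kan.
  have Uxy : x - y \in U k by apply/pE; rewrite linearB yx subrr.
  have := (Ucl a an).2 1 _ _ (series_mono Us kan Uxy) Uy.
  by rewrite scale1r subrK.
have kjn j : (j <= n - k)%N -> (k <= k + j <= n)%N.
  by move=> jn; rewrite leq_addr -leq_subRL.
exists (fun j => im_pred p (U (k + j)%N)); split=> [j /kjn/andP[_ jn]|y|y|j jn].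
- exact/im_closed/Ucl.
- rewrite addn0; apply/im_predP/idP => [[x Ux <-]|].
    by rewrite inE; apply/eqP/pE.
  by rewrite inE => /eqP ->; exists 0; rewrite ?linear0 //; case: (Ucl k kn).
- rewrite subnKC //; have [x <-] := p_surj y; by rewrite mem_im // Un.
have lt_kjn : (k + j < n)%N by rewrite -ltn_subRL.
have kj : (k <= k + j <= n)%N by rewrite leq_addr ltnW.
have kj1 : (k <= k + j.+1 <= n)%N by rewrite leq_addr addnS.
have [UU nUU Umin] := U_simple _ lt_kjn; rewrite addnS in kj1 *.
split=> [_ /im_predP[x Ux <-]|im_sub|W Wcl UW WU].
- exact/mem_im/UU.
- by apply: nUU => x Ux; apply: imU => //; apply/im_sub/mem_im.
case: (Umin _ (preim_closed p Wcl)) => [x Ux|x|UpW|UpW].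
- by rewrite inE; apply/UW/mem_im.
- by rewrite inE => /WU; apply: imU.
- by left=> y; have [x <-] := p_surj y => Wx; apply/mem_im/UpW.
- by right=> _ /im_predP[x /UpW Wx <-].
Qed.

Lemma iso_composition_length (M N : fgmod A) n :
  iso M N -> composition_length M n -> composition_length N n.
Proof.
move=> /isoP[f [g [fK gK]]] [U Us]; rewrite -(subn0 n).
apply: (factor_series (p := f) Us) => // [y|x]; first by exists (g y).
have [_ U0 _ _] := Us; rewrite U0 inE.
split=> [fx|/eqP ->]; last exact: linear0.
exact/eqP/(injective_eq0 (can_inj fK)).
Qed.

(** The terms up to U k form a composition series of the submodule U k. *)
Lemma sub_series M N n (U : nat -> {pred M}) (i : {linear N -> M}) k :
  composition_series n U -> (k <= n)%N -> injective i ->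
  (forall x, x \in U k <-> exists y, i y = x) -> composition_length N k.
Proof.
move=> Us kn i_inj iE; have [Ucl U0 Un U_simple] := Us.
have lift a x : (a <= k)%N -> x \in U a -> exists y, i y = x.
  by move=> ak Ux; apply/iE; apply: series_mono Us _ _ Ux; rewrite ak.
exists (fun j => preim_pred i (U j)); split=> [j jk|y|y|j jk].
- exact/preim_closed/Ucl/(leq_trans jk).
- rewrite !inE U0 inE; apply/eqP/eqP => [/(injective_eq0 i_inj) //|->].
  exact: linear0.
- by rewrite !inE; apply/iE; exists y.
have [UU nUU Umin] := U_simple _ (leq_trans jk kn).
split=> [y|preim_sub|W Wcl UW WU].
- by rewrite !inE; apply: UU.
- apply: nUU => x Ux; have [y yx] := lift _ _ jk Ux.
  by rewrite -yx; apply: (preim_sub y); rewrite inE yx.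
case: (Umin _ (im_closed i Wcl)) => [x Ux|_ /im_predP[y /WU Wy <-] //|imW|imW].
- have [y yx] := lift _ _ (ltnW jk) Ux; rewrite -yx; apply/mem_im/UW.
  by rewrite inE yx.
- by left=> y Wy; rewrite inE; apply/imW/mem_im.
by right=> y; rewrite inE => /imW/im_predP[z Wz /i_inj <-].
Qed.
End CompositionSeries.

(** * The chains of factors of P_i and of submodules of I_i *)
Section ChainFamily.
Context {F : fieldType} {A : falgType F}.
Implicit Types M N X Y Z P I : fgmod A.

(** The shape shared by the factors of the P_i and the submodules of the I_i:
    T lists the nonzero uniserial modules without repetition, as chains for K,
    and T i l has length l + 1.  The index l ranges over nat rather than over
    'I_(c i), and only the values l < c i matter; families can then be
    reindexed along a permutation of 'I_r without casts. *)
Definition chain_family (K : fgmod A -> fgmod A -> Prop) r (c : 'I_r -> nat)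
    (T : 'I_r -> nat -> fgmod A) : Prop :=
  [/\ forall i l, (l < c i)%N ->
        uniserial (T i l) /\ composition_length (T i l) l.+1,
      forall i j l m, (l < c i)%N -> (m < c j)%N ->
        K (T i l) (T j m) <-> i = j /\ (m <= l)%N &
      forall N, uniserial N -> ~ zero_mod N ->
        exists i l, (l < c i)%N /\ iso N (T i l)].

(** The member of length l + 1 is the quotient by the term U (n - (l + 1)) of
    the composition series, and all submodules of P are terms. *)
Lemma factor_chain P n : uniserial P -> composition_length P n ->
  exists T : nat -> fgmod A,
    [/\ forall l, (l < n)%N ->
          is_factor P (T l) /\ composition_length (T l) l.+1,
        forall l m, (m <= l < n)%N -> is_factor (T l) (T m) &
        forall N, is_factor P N -> ~ zero_mod N ->
          exists l, (l < n)%N /\ iso N (T l)].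
Proof.
move=> uP [U Us]; have [Ucl U0 Un _] := Us.
have [l|T T_] := choice (P := fun l N => (l < n)%N ->
    exists p : {linear P -> N},
      surjective p /\ forall x, x \in U (n - l.+1)%N <-> p x = 0).
  have [N [p pE]] := quotient_projection (Ucl _ (leq_subr l.+1 n)).
  by exists N => _; exists p.
exists T; split=> [l ln|l m /andP[ml ln]|N [q q_surj] N0].
- have [p [p_surj pE]] := T_ l ln; split; first by exists p.
  rewrite -(subKn ln); apply: (factor_series Us (leq_subr _ _) p_surj) => x.
  by split=> /pE.
- have [p [p_surj pE]] := T_ l ln.
  have [q [q_surj qE]] := T_ m (leq_ltn_trans ml ln).
  have [x /pE Ux|h hE] := factor_through (g := q) p_surj.
    by apply/qE; apply: series_mono Us _ _ Ux; rewrite leq_sub2l // leq_subr.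
  by exists h => y; have [x <-] := q_surj y; exists (p x); rewrite hE.
have [k kn kerq] := series_submodule uP Us (ker_closed q).
have k_lt : (k < n)%N.
  rewrite ltn_neqAle kn andbT; apply/eqP => kn'; apply: N0 => y.
  have [x <-] := q_surj y; apply/eqP.
  by have := kerq x; rewrite kn' Un !inE.
have l_lt : (n - k.+1 < n)%N by rewrite ltn_subrL /= (leq_ltn_trans _ k_lt).
exists (n - k.+1)%N; split=> //.
have [p [p_surj]] := T_ _ l_lt.
rewrite subnSK // subKn // => pE.
have qE x : q x = 0 <-> x \in U k.
  by rewrite -kerq inE; split=> /eqP.
have [x /qE/pE //|h hE] := factor_through (g := p) q_surj.
apply: (bij_iso (f := h)) => [|y]; last first.
  by have [x <-] := p_surj y; exists (q x); rewrite hE.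
apply: hom_injective => y; have [x <-] := q_surj y.
by rewrite hE => /pE/qE.
Qed.

(** The member of length l + 1 is the term U (l + 1). *)
Lemma sub_chain I n : uniserial I -> composition_length I n ->
  exists T : nat -> fgmod A,
    [/\ forall l, (l < n)%N ->
          is_sub I (T l) /\ composition_length (T l) l.+1,
        forall l m, (m <= l < n)%N -> is_sub (T l) (T m) &
        forall N, is_sub I N -> ~ zero_mod N ->
          exists l, (l < n)%N /\ iso N (T l)].
Proof.
move=> uI [U Us]; have [Ucl U0 Un _] := Us.
have [l|T T_] := choice (P := fun l N => (l < n)%N ->
    exists i : {linear N -> I},
      injective i /\ forall x, x \in U l.+1 <-> exists y, i y = x).
  have [ln|ln] := boolP (l < n)%N; last by exists I.
  by have [N [i iE]] := submodule_embedding (Ucl _ ln); exists N => _; exists i.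
exists T; split=> [l ln|l m /andP[ml ln]|N [j j_inj] N0].
- have [i [i_inj iE]] := T_ l ln; split; first by exists i.
  exact: (sub_series Us ln i_inj iE).
- have [i [i_inj iE]] := T_ l ln.
  have [j [j_inj jE]] := T_ m (leq_ltn_trans ml ln).
  have [x|h hE] := lift_through (g := j) i_inj.
    apply/iE; apply: (@series_mono _ _ _ n U m.+1) => //.
      by rewrite ltnS ml.
    by apply/jE; exists x.
  by exists h => x y xy; apply: j_inj; rewrite -!hE xy.
have [k kn imj] := series_submodule uI Us (im_closed j (predT_closed N)).
case: k => [|k] in kn imj.
  case: N0 => x; apply: (injective_eq0 j_inj); apply/eqP.
  by have := imj (j x); rewrite (mem_im j) // U0 inE => <-.
exists k; split=> //; have [i [i_inj iE]] := T_ k kn.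
have [x|h hE] := lift_through (g := j) i_inj.
  by apply/iE; rewrite -imj mem_im.
apply: (bij_iso (f := h)) => [x y xy|y]; first by apply: j_inj; rewrite -!hE xy.
have : i y \in U k.+1 by apply/iE; exists y.
by rewrite -imj => /im_predP[x _ xy]; exists x; apply: i_inj; rewrite hE.
Qed.

(** The kernel of P_k ->> S_k is superfluous and maximal, hence contains every
    proper submodule, and every nonzero factor N of P_k maps onto S_k.
    As the kernels of the two maps from N onto simple modules are comparable,
    one of these maps factors through the other, and the simple modules are
    isomorphic. *)
Lemma cover_top_unique r (S P : 'I_r -> fgmod A) i j N :
  (forall i, simple_mod (S i)) -> (forall i j, iso (S i) (S j) -> i = j) ->
  (forall i, projective_cover (P i) (S i)) -> (forall i, uniserial (P i)) ->
  ~ zero_mod N -> is_factor (P i) N -> is_factor (P j) N -> i = j.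
Proof.
move=> hS hS_neq hP uP N0 iN jN.
have uN : uniserial N.
  by case: iN => f f_surj; apply: uniserial_factor f_surj (uP i).
have top k : is_factor (P k) N -> exists t : {linear N -> S k}, surjective t.
  move=> [f f_surj]; have [_ [p [p_surj supp]]] := hP k.
  have [x fx|t tE] := factor_through (g := p) f_surj; last first.
    by exists t => y; have [x <-] := p_surj y; exists (f x); rewrite tE.
  apply: contrapT => px; have kerf : ker_pred f =i predT.
    apply: supp => [|y]; first exact: ker_closed.
    have [_ /(_ (im_pred p (ker_pred f)))[]] := hS k.
    - exact/im_closed/ker_closed.
    - by move=> /(_ (p x)); rewrite mem_im ?inE ?fx // => /esym/eqP.
    move=> /(_ (p y)); rewrite [RHS]inE => /im_predP[z fz pz].
    by exists z, (y - z); split; rewrite // ?linearB ?pz ?subrr // addrC subrK.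
  apply: N0 => y; have [z <-] := f_surj y; apply/eqP.
  by have := kerf z; rewrite !inE.
have [t t_surj] := top i iN; have [t' t'_surj] := top j jN.
have iso_case k l (u : {linear N -> S k}) (v : {linear N -> S l}) :
    surjective u -> surjective v -> (forall x, u x = 0 -> v x = 0) -> k = l.
  move=> u_surj v_surj uv; have [h hE] := factor_through u_surj uv.
  have h_surj : surjective h.
    by move=> y; have [x <-] := v_surj y; exists (u x); rewrite hE.
  have [y y0] := nonzero_mod (hS l).1; have [x xy] := h_surj y.
  apply: hS_neq; apply: bij_iso h_surj.
  by apply: simple_hom_injective (hS k) _; exists x; rewrite xy.
case: (comparable_kernels t t' uN) => [/iso_case|/iso_case ji]; first exact.
exact/esym/ji.
Qed.

(** S_k is essential in I_k, so every nonzero submodule N of I_k contains S_k.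
    The two simple submodules of N obtained in this way are comparable, hence
    isomorphic. *)
Lemma envelope_socle_unique r (S I : 'I_r -> fgmod A) i j N :
  (forall i, simple_mod (S i)) -> (forall i j, iso (S i) (S j) -> i = j) ->
  (forall i, injective_envelope (I i) (S i)) -> (forall i, uniserial (I i)) ->
  ~ zero_mod N -> is_sub (I i) N -> is_sub (I j) N -> i = j.
Proof.
move=> hS hS_neq hI uI N0 iN jN.
have uN : uniserial N by case: iN => f f_inj; apply: uniserial_sub f_inj (uI i).
have socle k : is_sub (I k) N -> exists t : {linear S k -> N}, injective t.
  move=> [f f_inj]; have [_ [s [s_inj ess]]] := hI k.
  have [x|t tE] := lift_through (g := s) f_inj; last first.
    by exists t => x y xy; apply: s_inj; rewrite -!tE xy.
  apply: contrapT => sx; have imf : im_pred f predT =i pred1 0.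
    apply: ess => [|y sy]; first exact: im_closed (predT_closed N).
    have [_ /(_ (preim_pred s (im_pred f predT)))[]] := hS k.
    - exact/preim_closed/im_closed/predT_closed.
    - move=> /(_ y); rewrite [LHS]sy => /esym; rewrite inE => /eqP ->.
      exact: linear0.
    move=> /(_ x); rewrite [RHS]inE => /im_predP[z _ zE].
    by case: sx; exists z.
  apply: N0 => y; apply: (injective_eq0 f_inj); apply/eqP.
  by have := imf (f y); rewrite mem_im // inE => <-.
have [t t_inj] := socle i iN; have [t' t'_inj] := socle j jN.
have iso_case k l (u : {linear S k -> N}) (v : {linear S l -> N}) :
    injective u -> injective v -> (forall x, exists y, v y = u x) -> k = l.
  move=> u_inj v_inj uv; have [h hE] := lift_through v_inj uv.
  have h_inj : injective h by move=> x y xy; apply: u_inj; rewrite -!hE xy.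
  have [x x0] := nonzero_mod (hS k).1.
  apply: hS_neq; apply: (bij_iso h_inj).
  apply: simple_hom_surjective (hS l) _; exists x => /(injective_eq0 h_inj).
  exact: x0.
case: (comparable_images t t' uN) => [/iso_case|/iso_case ji]; first exact.
exact/esym/ji.
Qed.
End ChainFamily.

Section Families.
Context {F : fieldType} {A : falgType F} {r : nat}.
Context {S P I : 'I_r -> fgmod A} {c d : 'I_r -> nat}.
Hypotheses (hA : nakayama A) (hS : forall i, simple_mod (S i)).
Hypothesis hS_neq : forall i j, iso (S i) (S j) -> i = j.
Hypothesis hS_all : forall M : fgmod A, simple_mod M -> exists i, iso M (S i).
Hypothesis hP : forall i, projective_cover (P i) (S i).
Hypothesis hI : forall i, injective_envelope (I i) (S i).
Hypothesis hc : forall i, composition_length (P i) (c i).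
Hypothesis hd : forall i, composition_length (I i) (d i).

Lemma is_factor_trans (M N K : fgmod A) :
  is_factor M N -> is_factor N K -> is_factor M K.
Proof.
move=> [f f_surj] [g g_surj]; exists (g \o f : {linear _ -> _}).
exact: surjective_comp.
Qed.

Lemma is_sub_trans (M N K : fgmod A) : is_sub M N -> is_sub N K -> is_sub M K.
Proof.
move=> [f f_inj] [g g_inj]; exists (f \o g : {linear _ -> _}).
exact: inj_comp.
Qed.

(** If T j m is a factor of T i l, the two have a common top, so i = j, and the
    length of a factor is at most that of the module, so m <= l. *)
Lemma factor_chain_family : exists T, chain_family (@is_factor F A) c T.
Proof.
have uP := @cover_uniserial _ _ _ _ _ hA hS hP.
have [i|T T_] := choice (P := fun i (T : nat -> fgmod A) =>
    [/\ forall l, (l < c i)%N ->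
          is_factor (P i) (T l) /\ composition_length (T l) l.+1,
        forall l m, (m <= l < c i)%N -> is_factor (T l) (T m) &
        forall N, is_factor (P i) N -> ~ zero_mod N ->
          exists l, (l < c i)%N /\ iso N (T l)]).
  exact: factor_chain.
have uT i l : (l < c i)%N -> uniserial (T i l).
  move=> lc; have [/(_ l lc)[[f f_surj] _] _ _] := T_ i.
  exact: uniserial_factor f_surj (uP i).
exists T; split=> [i l lc|i j l m lc mc|N uN N0].
- by split; [exact: uT|have [/(_ l lc)[]] := T_ i].
- have [/(_ l lc)[Pl Tl_len] chain _] := T_ i.
  have [/(_ m mc)[Pm Tm_len] _ _] := T_ j.
  split=> [Tlm|[ij ml]]; last first.
    by subst j; apply: chain; rewrite ml.
  split.
    have Tm0 := composition_length_nonzero Tm_len.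
    apply: (cover_top_unique hS hS_neq hP uP Tm0) Pm.
    exact: is_factor_trans Pl Tlm.
  have [f f_surj] := Tlm; have [U Us] := Tl_len.
  have [k kn kerf] := series_submodule (uT _ _ lc) Us (ker_closed f).
  have fE x : f x = 0 <-> x \in U k by rewrite -kerf inE; split=> /eqP.
  have len := factor_series Us kn f_surj fE.
  by rewrite -ltnS (composition_length_unique (uT _ _ mc) Tm_len len) leq_subr.
have [i PN] := uniserial_factor_cover hS_all hP uN N0.
by have [_ _ /(_ N PN N0)[l [lc Nl]]] := T_ i; exists i, l.
Qed.

(** If T j m embeds in T i l, the two have a common socle, so i = j, and the
    length of a submodule is at most that of the module, so m <= l. *)
Lemma sub_chain_family : exists T, chain_family (@is_sub F A) d T.
Proof.
have uI := @envelope_uniserial _ _ _ _ _ hA hS hI.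
have [i|T T_] := choice (P := fun i (T : nat -> fgmod A) =>
    [/\ forall l, (l < d i)%N ->
          is_sub (I i) (T l) /\ composition_length (T l) l.+1,
        forall l m, (m <= l < d i)%N -> is_sub (T l) (T m) &
        forall N, is_sub (I i) N -> ~ zero_mod N ->
          exists l, (l < d i)%N /\ iso N (T l)]).
  exact: sub_chain.
have uT i l : (l < d i)%N -> uniserial (T i l).
  move=> lc; have [/(_ l lc)[[f f_inj] _] _ _] := T_ i.
  exact: uniserial_sub f_inj (uI i).
exists T; split=> [i l lc|i j l m lc mc|N uN N0].
- by split; [exact: uT|have [/(_ l lc)[]] := T_ i].
- have [/(_ l lc)[Il Tl_len] chain _] := T_ i.
  have [/(_ m mc)[Im Tm_len] _ _] := T_ j.
  split=> [Tlm|[ij ml]]; last first.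
    by subst j; apply: chain; rewrite ml.
  split.
    have Tm0 := composition_length_nonzero Tm_len.
    apply: (envelope_socle_unique hS hS_neq hI uI Tm0) Im.
    exact: is_sub_trans Il Tlm.
  have [f f_inj] := Tlm; have [U Us] := Tl_len.
  have fcl := im_closed f (predT_closed _).
  have [k kn imf] := series_submodule (uT _ _ lc) Us fcl.
  have fE x : x \in U k <-> exists y, f y = x.
    rewrite -imf; split=> [/im_predP[y _ yx]|[y <-]]; first by exists y.
    exact: mem_im.
  have len := sub_series Us kn f_inj fE.
  by rewrite -ltnS (composition_length_unique (uT _ _ mc) Tm_len len).
have [i IN] := uniserial_sub_envelope hS_all hI uN N0.
by have [_ _ /(_ N IN N0)[l [lc Nl]]] := T_ i; exists i, l.
Qed.
End Families.

(** * Closed subcategories and products of chains *)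
Section IsoRepr.
Context {F : fieldType} {A : falgType F}.
Implicit Types M N : fgmod A.

Lemma iso_reprP M : iso M (iso_repr M).
Proof.
rewrite /iso_repr; apply/asboolP.
by apply: (chooseP (P := fun N => `[< iso M N >])); apply/asboolP/iso_refl.
Qed.

Lemma iso_repr_eq M N : iso M N -> iso_repr M = iso_repr N.
Proof.
move=> MN; rewrite /iso_repr.
have MNE : (fun X => `[< iso M X >]) =1 (fun X => `[< iso N X >]).
  by move=> X; apply/asboolP/asboolP; apply: iso_trans => //; apply: iso_sym.
rewrite (eq_choose MNE); apply: choose_id; apply/asboolP; last exact: iso_refl.
exact: iso_sym.
Qed.

Lemma iso_indecomposable M N : iso M N -> indecomposable M -> indecomposable N.
Proof.
move=> MN [M0 M_indec]; split=> [N0|X Y [f [f' fK f'K]]].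
  by apply: M0; apply: iso_zero N0; apply: iso_sym.
have [g [g' [gK g'K]]] := isoP MN.
apply: M_indec; exists (f \o g : {linear _ -> _}), (g' \o f') => x /=.
  by rewrite fK gK.
by rewrite g'K f'K.
Qed.
End IsoRepr.

Section GradedIso.
Context {dT dU dV : Order.disp_t}.
Context {T : latticeType dT} {U : latticeType dU} {V : latticeType dV}.

Lemma order_iso_graded (f : T -> U) gT gU :
  bijective f -> {mono f : x y / (x <= y)%O} -> (forall x, gU (f x) = gT x) ->
  graded_lattice_iso gT gU.
Proof.
move=> [g fK gK] f_mono f_grade; exists f; split=> //; first by exists g.
  move=> x y; apply: le_anti; apply/andP; split.
    by rewrite lexI !f_mono leIl leIr.
  by rewrite -[leLHS]gK f_mono lexI -!f_mono !gK leIl leIr.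
move=> x y; apply: le_anti; apply/andP; split.
  by rewrite -[leRHS]gK f_mono leUx -!f_mono !gK leUl leUr.
by rewrite leUx !f_mono leUl leUr.
Qed.

(** Both lattices are compared with a third one, V, and the second comparison
    is inverted. *)
Lemma graded_iso_common_target gT gU gV :
  @graded_lattice_iso _ _ T V gT gV -> @graded_lattice_iso _ _ U V gU gV ->
  @graded_lattice_iso _ _ T U gT gU.
Proof.
move=> [f [[f' fK f'K] f_meet f_join f_grade]].
move=> [h [[h' hK h'K] h_meet h_join h_grade]].
exists (h' \o f); split=> [|x y|x y|x] /=.
- by exists (f' \o h) => x /=; rewrite ?h'K ?fK ?f'K ?hK.
- by apply: (can_inj hK); rewrite h_meet !h'K f_meet.
- by apply: (can_inj hK); rewrite h_join !h'K f_join.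
by rewrite -h_grade h'K f_grade.
Qed.
End GradedIso.

Lemma fset_image_setE (X : finType) (Y : choiceType) (D : {pred X})
    (f : X -> Y) :
  [set y | exists2 x, x \in D & f x = y]%classic
    = [set` [fset f x | x in D]%fset]%classic.
Proof.
apply/seteqP; split=> y /= [].
  by move=> x Dx <-; apply/imfsetP; exists x.
by move/imfsetP => [x Dx ->]; exists x.
Qed.

Lemma card_fset_set_image (X : finType) (Y : choiceType) (D : {pred X})
    (f : X -> Y) : injective f ->
  #|` fset_set [set y | exists2 x, x \in D & f x = y]%classic| = #|D|.
Proof.
by move=> f_inj; rewrite fset_image_setE set_fsetK card_imfset // cardE.
Qed.

Section Lattice.
Context {F : fieldType} {A : falgType F}.
Context {K : fgmod A -> fgmod A -> Prop}.
Context {r : nat} {c : 'I_r -> nat} {T : 'I_r -> nat -> fgmod A}.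
Implicit Types M N X Y Z : fgmod A.
(* The properties of K common to the relations of being a factor and of being a
   submodule; K_prime is the one that rests on uniseriality. *)
Hypothesis ind_uni : forall M, indecomposable M -> uniserial M.
Hypothesis K_iso : forall M N, iso M N -> K M N.
Hypothesis K_trans : forall M N X, K M N -> K N X -> K M X.
Hypothesis K_summand : forall X Y Z, lmod_iso Z (X * Y)%type -> K Z X /\ K Z Y.
Hypothesis K_prime : forall X Y Z N, lmod_iso Z (X * Y)%type -> uniserial N ->
  K Z N -> K X N \/ K Y N.
Hypothesis K_zero : forall M N, zero_mod M -> K M N -> zero_mod N.
Hypothesis T_chain : chain_family K c T.
Local Notation L := (closed_subcat K).

Let T_indec i l : (l < c i)%N -> indecomposable (T i l).
Proof.
case: T_chain => /(_ i l) T_ _ _ /T_[uT T_len].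
exact: uniserial_indecomposable uT (composition_length_nonzero T_len).
Qed.

Let T_le i j l m : (l < c i)%N -> (m < c j)%N ->
  K (T i l) (T j m) <-> i = j /\ (m <= l)%N.
Proof. by case: T_chain => _ T_K _; apply: T_K. Qed.

Let T_all N : indecomposable N -> exists i l, (l < c i)%N /\ iso N (T i l).
Proof.
move=> N_indec; case: T_chain => _ _; apply; first exact: ind_uni.
by case: N_indec.
Qed.

Let T_inj i j l m : (l < c i)%N -> (m < c j)%N -> iso (T i l) (T j m) ->
  i = j /\ l = m.
Proof.
move=> lc mc lm; have /(T_le lc mc)[-> ml] := K_iso lm.
have /(T_le mc lc)[_ lm'] := K_iso (iso_sym lm).
by split=> //; apply/eqP; rewrite eqn_leq lm' ml.
Qed.

Let L_iso (C : L) M N : iso M N -> subcat_obj C M <-> subcat_obj C N.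
Proof.
by move=> MN; split; apply: (subcat_iso (subcatP C)) => //; apply: iso_sym.
Qed.

(** By induction on the dimension: a decomposable module is the sum of two
    smaller modules, which belong to C as summands. *)
Lemma subcat_le_indecomposables (C D : L) :
  (forall N, indecomposable N -> subcat_obj C N -> subcat_obj D N) ->
  (C <= D)%O.
Proof.
move=> CD; apply/subcat_leP => M; have [n] := ubnP (fgmod_dim M).
elim: n M => // n IHn M /ltnSE Mn CM.
have [M0|M0] := pselect (zero_mod M); first exact: (subcat0 (subcatP D)).
have [/CD|] := pselect (indecomposable M); first exact.
move=> M_dec; have [X [Y [MXY X0 Y0]]] : exists X Y,
    [/\ lmod_iso M (X * Y)%type, ~ zero_mod X & ~ zero_mod Y].
  apply: contrapT => noXY; apply: M_dec; split=> // X Y MXY.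
  have [X0|X0] := pselect (zero_mod X); first by left.
  by right; apply: contrapT => Y0; apply: noXY; exists X, Y.
have [p [q [i [j [ip jq qi pj Mpq]]]]] := dsum_homs MXY.
have dim_lt (W W' : fgmod A) (k : {linear W -> M}) (w : {linear M -> W'})
    (l : {linear W' -> M}) : injective k -> cancel l w ->
    (forall x, w (k x) = 0) -> ~ zero_mod W' ->
    (fgmod_dim W < fgmod_dim M)%N.
  move=> k_inj lw wk W'0; rewrite ltnNge; apply/negP => le.
  have [_ /(_ le) k_surj] := injective_dim k_inj; apply: W'0 => y.
  by have [x xl] := k_surj (l y); rewrite -(lw y) -xl wk.
have [CX CY] := subcat_summand (subcatP C) MXY CM.
apply: (subcat_dsum (subcatP D) MXY); apply: IHn => //.
  exact: leq_trans (dim_lt _ _ i q j (can_inj ip) jq qi Y0) Mn.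
exact: leq_trans (dim_lt _ _ j p i (can_inj jq) ip pj X0) Mn.
Qed.

(** The members of C in a chain form an initial segment because C is closed
    under K; n is the number of these members. *)
Lemma chain_cut (C : L) i :
  exists n : 'I_(c i).+1,
    forall l, (l < c i)%N -> subcat_obj C (T i l) <-> (l < n)%N.
Proof.
pose Q n := (n == c i) || ~~ `[< subcat_obj C (T i n) >].
have exQ : exists n, Q n by exists (c i); rewrite /Q eqxx.
case: (ex_minnP exQ) => n Qn minn.
have nc : (n <= c i)%N by apply: minn; rewrite /Q eqxx.
have nc1 : (n < (c i).+1)%N by [].
exists (Ordinal nc1) => l lc /=; split=> [Cl|ln].
  rewrite ltnNge; apply/negP => nl.
  have nc' := leq_ltn_trans nl lc; case/orP: Qn => [/eqP nE|/asboolP].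
    by rewrite nE ltnn in nc'.
  by apply; apply: subcat_closed Cl; apply/(T_le lc nc').
apply: contrapT => nCl.
have /minn : Q l by rewrite /Q; apply/orP; right; apply/asboolP.
by rewrite leqNgt ln.
Qed.

(** The subcategory attached to a vector of segment sizes is described by the
    members of the chains reached from M through K, not by the summands of M;
    its closure properties then need no uniqueness of decompositions. *)
Definition bounded_subcat (x : chain_prod c) : set (fgmod A) :=
  [set M | forall i l, (l < c i)%N -> K M (T i l) -> (l < x i)%N]%classic.

Lemma bounded_is_subcat x : is_subcat (bounded_subcat x).
Proof.
split=> [M M0 i l lc Kl|M N MN CM i l lc Kl
        |X Y Z ZXY CX CY i l lc Kl|X Y Z ZXY CZ].
- by case: (T_indec lc) => + _; case; apply: K_zero Kl.
- by apply: CM => //; apply: K_trans Kl; apply: K_iso.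
- have [+ _ _] := T_chain => /(_ i l lc)[uT _].
  by have [/(CX _ _ lc)|/(CY _ _ lc)] := K_prime ZXY uT Kl.
have [ZX ZY] := K_summand ZXY.
by split=> i l lc Kl; apply: CZ => //; [apply: K_trans Kl|apply: K_trans Kl].
Qed.

Lemma bounded_closed x M N : K M N -> bounded_subcat x M -> bounded_subcat x N.
Proof. by move=> MN CM i l lc Kl; apply: CM => //; apply: K_trans Kl. Qed.

Definition ind_rep (t : {i : 'I_r & 'I_(c i)}) : fgmod A :=
  iso_repr (T (tag t) (tagged t)).

Lemma ind_rep_inj : injective ind_rep.
Proof.
move=> [i l] [j m]; rewrite /ind_rep /= => lm.
have : iso (T i l) (T j m).
  by apply: iso_trans (iso_reprP _) _; rewrite lm; apply/iso_sym/iso_reprP.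
move=> /(T_inj (ltn_ord l) (ltn_ord m))[ij]; subst j => /val_inj lm'.
by rewrite lm'.
Qed.

Lemma indE : ind A = [set N | exists2 t, t \in predT & ind_rep t = N]%classic.
Proof.
apply/seteqP; split=> N [].
  move=> /T_all[i [l [lc Nl]]] NN.
  exists (Tagged (fun i => 'I_(c i)) (Ordinal lc)) => //.
  by rewrite /ind_rep /= -(iso_repr_eq Nl).
move=> [i l] _ <-; rewrite /ind_rep /=; split; last first.
  exact/esym/iso_repr_eq/iso_reprP.
exact: iso_indecomposable (iso_reprP _) (T_indec (ltn_ord l)).
Qed.

Lemma finite_ind : finite_set (ind A).
Proof. by rewrite indE fset_image_setE; apply: finite_fset. Qed.

Theorem subcat_lattice_iso :
  graded_lattice_iso (fun C : L => subcat_size C)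
    (fun x : chain_prod c => chain_grade x).
Proof.
have [C|f fP] := choice (P := fun (C : L) (x : chain_prod c) =>
    forall i l, (l < c i)%N -> subcat_obj C (T i l) <-> (l < x i)%N).
  have [n n_] : exists n : forall i, 'I_(c i).+1, forall i l, (l < c i)%N ->
      subcat_obj C (T i l) <-> (l < n i)%N.
    by exists (fun i => projT1 (cid (chain_cut C i))) => i; case: cid.
  exists ([ffun i => n i] : chain_prod c) => i l; rewrite ffunE; exact: n_.
have f_mono : {mono f : C D / (C <= D)%O}.
  move=> C D; apply/forallP/idP => [fCD|/subcat_leP CD i].
    apply: subcat_le_indecomposables => N /T_all[i [l [lc Nl]]].
    move=> /(L_iso C Nl)/(fP _ _ _ lc) lC; apply/(L_iso D Nl)/(fP _ _ _ lc).
    exact: leq_trans lC (fCD i).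
  rewrite -[(_ <= _)%O]/(f C i <= f D i)%N leqNgt; apply/negP => DC.
  have lc : (f D i < c i)%N by apply: leq_trans DC (leq_ord _).
  by have /CD/(fP _ _ _ lc) := (fP C i _ lc).2 DC; rewrite ltnn.
have f_surj x : exists C, f C = x.
  pose C : L := ClosedSubcat (bounded_is_subcat x) (@bounded_closed x).
  exists C; apply/ffunP => i; apply/val_inj/eqP; rewrite eqn_leq /=.
  have CE l : (l < c i)%N -> (l < f C i)%N = (l < x i)%N.
    move=> lc; apply/idP/idP => [/(fP C i l lc)|lx].
      by apply=> //; apply/(T_le lc lc).
    apply/(fP C i l lc) => j m mc /(T_le lc mc)[ij ml]; subst j.
    exact: leq_ltn_trans ml lx.
  apply/andP; split; rewrite leqNgt; apply/negP => lt.
    have lc := leq_trans lt (leq_ord (f C i)).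
    by move: lt; rewrite CE // ltnn.
  have lc := leq_trans lt (leq_ord (x i)).
  by move: lt; rewrite -CE // ltnn.
have [g gK] := choice f_surj.
apply: (order_iso_graded (f := f)) => [|//|C].
  by exists g => // C; apply: le_anti; rewrite -!f_mono gK lexx.
pose D : {pred {i : 'I_r & 'I_(c i)}} :=
  [pred t : {i : 'I_r & 'I_(c i)} | (tagged t < f C (tag t))%N].
rewrite /subcat_size.
have -> : (ind A `&` C = [set N | exists2 t, t \in D & ind_rep t = N])%classic.
  rewrite indE; apply/seteqP; split=> N /= [].
    move=> [[i l] _ <-]; rewrite /ind_rep /=.
    move=> /(L_iso C (iso_reprP (T i l)))/(fP C i l (ltn_ord l)) lf.
    by exists (Tagged (fun i => 'I_(c i)) l).
  move=> [i l] lf <-; split; first by exists (Tagged (fun i => 'I_(c i)) l).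
  apply: (L_iso C (iso_reprP (T i l))).1.
  exact: (fP C i l (ltn_ord l)).2.
rewrite card_fset_set_image; last exact: ind_rep_inj.
rewrite -sum1_card /chain_grade.
transitivity (\sum_(i < r) \sum_(l < c i | l < f C i) 1)%N.
  apply: eq_bigr => i _; rewrite -(big_ord_widen _ (fun _ => 1%N)) ?leq_ord //.
  by rewrite sum1_card card_ord.
by rewrite (sig_big_dep _ (fun i (l : 'I_(c i)) => (l < f C i)%N)).
Qed.
End Lattice.

(** * Comparison of the two families of chains *)
Section Comparison.
Context {F : fieldType} {A : falgType F}.
Context {K K' : fgmod A -> fgmod A -> Prop}.
Hypothesis K_iso : forall M N, iso M N -> K M N.

(** A module of length l + 1 in a chain of one family is isomorphic to a member
    of the other family, of index l by uniqueness of the length; the member of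
    a chain of given length being unique, this is an injection between the
    chains with more than l members. *)
Lemma chain_family_count_le r (c d : 'I_r -> nat) T T' l :
  chain_family K c T -> chain_family K' d T' ->
  (#|[set i | (l < c i)%N]| <= #|[set i | (l < d i)%N]|)%N.
Proof.
move=> [T_ T_K _] [T'_ _ T'_all].
have [i|s s_] := choice (P := fun i j => (l < c i)%N ->
    (l < d j)%N /\ iso (T i l) (T' j l)).
  have [lc|_] := boolP (l < c i)%N; last by exists i.
  have [uT T_len] := T_ i l lc.
  have [j [m [md Tm]]] := T'_all _ uT (composition_length_nonzero T_len).
  have [uT' T'_len] := T'_ j m md.
  have T'_len' := iso_composition_length Tm T_len.
  have [lm] := composition_length_unique uT' T'_len' T'_len.
  by exists j => _; rewrite lm in md Tm *.
rewrite -(@card_in_imset _ _ s) => [|i j].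
  apply/subset_leq_card/fintype.subsetP => _ /imsetP[i + ->].
  by rewrite !inE => /s_[].
rewrite !inE => lci lcj sij; have [_ Ti] := s_ i lci; have [_ Tj] := s_ j lcj.
have /K_iso/(T_K _ _ _ _ lci lcj)[] // : iso (T i l) (T j l).
by apply: iso_trans Ti _; rewrite sij; apply: iso_sym.
Qed.

Lemma chain_family_reindex r (c d : 'I_r -> nat) T (s : 'I_r -> 'I_r) :
  bijective s -> (forall i, c i = d (s i)) -> chain_family K d T ->
  chain_family K c (fun i => T (s i)).
Proof.
move=> [s' sK s'K] cE [T_ T_K T_all]; split=> [i l|i j l m|N uN N0].
- by rewrite cE; apply: T_.
- rewrite !cE => lc mc.
  split=> [/(T_K _ _ _ _ lc mc)[/(can_inj sK)]|[ij ml]] //.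
  by apply/(T_K _ _ _ _ lc mc); rewrite ij.
by have [i [l [ld Nl]]] := T_all N uN N0; exists (s' i), l; rewrite cE s'K.
Qed.
End Comparison.

(** The multiplicity of x is #{i | x <= c i} - #{i | x < c i}; the first
    cardinal is r for x = 0, and is given by the hypothesis at x - 1
    otherwise. *)
Lemma perm_eq_codom_count r (c d : 'I_r -> nat) :
  (forall l, #|[set i | (l < c i)%N]| = #|[set i | (l < d i)%N]|) ->
  perm_eq (codom c) (codom d).
Proof.
move=> cd.
have count_eq (e : 'I_r -> nat) x :
    (count_mem x (codom e) + #|[set i | (x < e i)%N]|
      = #|[set i | (x <= e i)%N]|)%N.
  have -> : count_mem x (codom e) = #|[set i | e i == x]|.
    rewrite count_map cardE size_filter -enumT; apply: eq_count => i.
    by rewrite /= inE.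
  rewrite -cardsUI [X in (_ + X)%N]eq_card0 ?addn0 => [|i].
    by apply: eq_card => i; rewrite !inE [RHS]leq_eqVlt eq_sym.
  by rewrite !inE; case: eqP => // ->; rewrite ltnn.
apply/allP => x _ /=; apply/eqP.
apply: (@addIn #|[set i | (x < d i)%N]|); rewrite -{1}cd !count_eq.
case: x => [|x]; last exact: cd.
by apply: eq_card => i; rewrite !inE.
Qed.

Lemma perm_eq_codom_perm r (c d : 'I_r -> nat) :
  perm_eq (codom c) (codom d) ->
  exists s : 'I_r -> 'I_r, bijective s /\ forall i, c i = d (s i).
Proof.
move=> cd.
have /tuple_permP[s sE] : perm_eq (codom c) [tuple d i | i < r] by [].
exists s; split=> [|i]; first by exists (s^-1)%g; [exact: permK|exact: permKV].
by move/eq_in_map: sE => /(_ i (mem_enum _ _)); rewrite tnth_mktuple.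
Qed.

(** * Rank polynomials *)
Lemma rank_poly_fin (T : choiceType) (X : finType) (gT : T -> nat)
    (gX : X -> nat) (f : T -> X) :
  bijective f -> (forall x, gX (f x) = gT x) ->
  rank_poly gT = \sum_x 'X^(gX x).
Proof.
move=> [g fK gK] f_grade.
have card_gT i :
    #|` fset_set [set t | gT t = i]%classic| = #|[pred x | gX x == i]|.
  rewrite -(card_fset_set_image _ (can_inj gK)); congr (#|` fset_set _|).
  apply/seteqP; split=> t /= [].
    by move=> <-; exists (f t); rewrite ?fK // inE f_grade.
  by move=> x /eqP <- <-; rewrite -f_grade gK.
(* No element has grade N or more, which bounds the sum over all degrees. *)
pose N := (\max_x gX x).+1.
have ltN x : (gX x < N)%N by rewrite ltnS leq_bigmax.
rewrite /rank_poly -(fsbig_widen (`I_N)%classic) //=; last first.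
  move=> i /= [_ iN]; rewrite card_gT eq_card0 ?scale0r // => x; rewrite !inE.
  by apply/eqP => xi; apply: iN; rewrite -xi.
rewrite -fsbig_ord (partition_big (fun x => Ordinal (ltN x)) xpredT) //=.
apply: eq_bigr => i _; rewrite card_gT scaler_nat.
rewrite (eq_bigr (fun=> 'X^i)) => [|x /eqP <- //].
by rewrite sumr_const; congr (_ *+ _); apply: eq_card => x; rewrite !inE.
Qed.

(** Distributivity of the product over the sums; the types 'I_(c i + 1) of the
    summation indices vary with i, hence the detour through their disjoint sum
    and the dependent products [fprod]. *)
Lemma chain_prod_poly r (c : 'I_r -> nat) :
  \sum_(x : chain_prod c) 'X^(chain_grade x) = \prod_(i < r) qint (c i).+1.
Proof.
pose J (i : 'I_r) : finType := 'I_(c i).+1.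
pose G (i : 'I_r) : {ffun J i -> {poly int}} := [ffun j : 'I_(c i).+1 => 'X^j].
transitivity (\prod_(i < r) \sum_(j : J i) G i j); last first.
  by apply: eq_bigr => i _; apply: eq_bigr => j _; rewrite ffunE.
rewrite (eq_bigr _ (fun i _ => big_tag (fun i (j : J i) => G i j) i)).
rewrite bigA_distr_big_dep -big_fprod.
rewrite (reindex (@fprod_of_dffun _ J)); last exact/onW_bij/fprod_of_dffun_bij.
apply: eq_bigr => x _; rewrite /chain_grade -prodrXr.
by apply: eq_bigr => i _; rewrite ffunE fprodE.
Qed.

Lemma rank_poly_chain (T : choiceType) r (c : 'I_r -> nat) (gT : T -> nat)
    (f : T -> chain_prod c) :
  bijective f -> (forall x, chain_grade (f x) = gT x) ->
  rank_poly gT = \prod_(i < r) qint (c i).+1.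
Proof.
move=> f_bij f_grade.
by rewrite (rank_poly_fin f_bij f_grade) chain_prod_poly.
Qed.

Theorem theorem4p2 (F : fieldType) (A : falgType F) (r : nat)
    (S P I : 'I_r -> fgmod A) (c d : 'I_r -> nat)
    (hA : nakayama A)
    (hS : forall i, simple_mod (S i))
    (hS_neq : forall i j, iso (S i) (S j) -> i = j)
    (hS_all : forall M : fgmod A, simple_mod M -> exists i, iso M (S i))
    (hP : forall i, projective_cover (P i) (S i))
    (hI : forall i, injective_envelope (I i) (S i))
    (hc : forall i, composition_length (P i) (c i))
    (hd : forall i, composition_length (I i) (d i)) :
  (* the sizes below are those of finite sets *)
  finite_set (ind A) /\
  graded_lattice_iso (fun C : Lquot A => subcat_size C)
    (fun x : chain_prod c => chain_grade x) /\
  (graded_lattice_iso (fun C : Lsub A => subcat_size C)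
     (fun x : chain_prod d => chain_grade x) /\
   perm_eq (codom c) (codom d) /\
   graded_lattice_iso (fun C : Lquot A => subcat_size C)
     (fun C : Lsub A => subcat_size C)) /\
  (Rquot A = \prod_(i < r) qint (c i).+1 /\
   Rsub A = \prod_(i < r) qint (c i).+1).
Proof.
have ind_uni := indecomposable_uniserial hA hS hS_all hP hI.
have factor_iso (M N : fgmod A) : iso M N -> is_factor M N.
  by move=> /isoP[f [g [_ gK]]]; exists f => y; exists (g y).
have sub_iso (M N : fgmod A) : iso M N -> is_sub M N.
  by move=> /isoP[f [g [_ gK]]]; exists g; apply: can_inj gK.
have [T T_chain] := factor_chain_family hA hS hS_neq hS_all hP hc.
have [T' T'_chain] := sub_chain_family hA hS hS_neq hS_all hI hd.
have quot_iso : graded_lattice_iso (fun C : Lquot A => subcat_size C)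
    (fun x : chain_prod c => chain_grade x).
  apply: subcat_lattice_iso T_chain => //; first exact: is_factor_trans.
  - move=> X Y Z /dsum_homs[p [q [i [j [ip jq _ _ _]]]]].
    by split; [exists p => x; exists (i x)|exists q => y; exists (j y)].
  - by move=> X Y Z N ZXY uN [f]; apply: dsum_factor_uniserial ZXY uN.
  move=> M N M0 [f f_surj] y; have [x <-] := f_surj y.
  by rewrite (M0 x) linear0.
have sub_lattice e T0 : chain_family (@is_sub F A) e T0 ->
    graded_lattice_iso (fun C : Lsub A => subcat_size C)
      (fun x : chain_prod (r := r) e => chain_grade x).
  apply: subcat_lattice_iso => //.
  - by move=> M N X MN NX; apply: is_sub_trans NX.
  - move=> X Y Z /dsum_homs[p [q [i [j [ip jq _ _ _]]]]].
    by split; [exists i; apply: can_inj ip|exists j; apply: can_inj jq].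
  - by move=> X Y Z N ZXY uN [f]; apply: dsum_sub_uniserial ZXY uN.
  by move=> M N M0 [f f_inj] y; apply: f_inj; rewrite (M0 (f y)) linear0.
have cd : perm_eq (codom c) (codom d).
  apply: perm_eq_codom_count => l; apply/eqP; rewrite eqn_leq.
  by rewrite (chain_family_count_le factor_iso l T_chain T'_chain)
             (chain_family_count_le sub_iso l T'_chain T_chain).
(* The chains of submodules, listed in the order given by s, have the sizes
   c i, so that both lattices are compared with the same product of chains. *)
have [s [s_bij cE]] := perm_eq_codom_perm cd.
have sub_iso_c := sub_lattice _ _ (chain_family_reindex s_bij cE T'_chain).
split; first exact: (finite_ind ind_uni T_chain).
split=> //; split; last first.
  split.
    have [f [f_bij _ _ f_grade]] := quot_iso.
    exact: rank_poly_chain f_bij f_grade.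
  have [f [f_bij _ _ f_grade]] := sub_iso_c.
  exact: rank_poly_chain f_bij f_grade.
split; first exact: sub_lattice T'_chain.
split=> //; exact: graded_iso_common_target quot_iso sub_iso_c.
Qed.
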